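(* Consider a CWENOZ reconstruction in $n$ space dimensions, as defined in the context, with optimal polynomial $P_{\mathrm{opt}}\in\mathbb{P}^G_n$ and lower-degree polynomials $P_1,\dots,P_m\in\mathbb{P}^g_n$ ($g<G$), applied to the cell averages of a smooth function $u$, and whose polynomials have the accuracies $$|P_{\mathrm{opt}}(\mathbf{x})-u(\mathbf{x})|=\mathcal{O}(\rho^{G+1}),\qquad |P_k(\mathbf{x})-u(\mathbf{x})|=\mathcal{O}(\rho^{g+1})\quad(k=1,\dots,m)$$ uniformly for $\mathbf{x}\in\Omega_0$ as $\rho\to0$, for smooth $u$. Assume that, for some integer $M$ with $1\le M\le g$, each $q\in\{P_1,\dots,P_m,P_{\mathrm{opt}}\}$ satisfies, with the same $u$, $$\boldsymbol{\Delta}\mathbf{x}^{\boldsymbol\alpha-\mathbf 1}\int_{\Omega_0}\partial_{\boldsymbol\alpha}q(\mathbf{x})\,d\mathbf{x}=\sum_{\substack{|\boldsymbol\beta|=0\\ \boldsymbol\beta\text{ even}}}^{M-|\boldsymbol\alpha|}\frac{\partial_{\boldsymbol\alpha+\boldsymbol\beta}u(\mathbf 0)}{2^{|\boldsymbol\beta|}(\boldsymbol\beta+\mathbf 1)!}\boldsymbol{\Delta}\mathbf{x}^{\boldsymbol\alpha+\boldsymbol\beta}+\mathcal{O}(\rho^{M+1}),\qquad 1\le|\boldsymbol\alpha|\le M.$$ Assume further that $\epsilon=C_\epsilon\rho^{\hat m}$ with a constant $C_\epsilon\neq0$ (and $\epsilon>0$), and that the parameters $\hat m$ and $\ell\ge1$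 satisfy $$\text{(a)}\ \ \hat m\le 2M+1,\qquad \text{(b)}\ \ \ell\,(2M+2-\hat m)\ge G-g-1,\qquad \text{(c)}\ \ \ell\,\bigl[\theta(\tau)|_{n_{cp}=0}-\min(\hat m,2M)\bigr]\ge G-g-1.$$ Then on smooth data the CWENOZ reconstruction achieves the optimal order $G+1$ as $\rho\to0$: for smooth $u$ (whatever the order of a possible critical point of $u$ at $\mathbf 0$), $$|P_{\mathrm{rec}}^{\mathrm{CWZ}}(\mathbf{x})-u(\mathbf{x})|=\mathcal{O}(\rho^{G+1})\quad\text{uniformly for }\mathbf{x}\in\Omega_0 .$$
   Context: Multi-index notation: for $\boldsymbol\alpha\in\mathbb{N}^n$, $|\boldsymbol\alpha|=\sum_i\alpha_i$, $\boldsymbol\alpha!=\prod_i\alpha_i!$, $\mathbf{x}^{\boldsymbol\alpha}=\prod_i x_i^{\alpha_i}$, $\partial_{\boldsymbol\alpha}$ is the partial derivative of multi-order $\boldsymbol\alpha$, $\mathbf 1=(1,\dots,1)$; $\boldsymbol\alpha$ is even if every $\alpha_i$ is even. $\mathbb{P}^k_n$ is the space of real polynomials in $n$ variables of degree at most $k$. Grid: a uniform Cartesian grid of $\mathbb{R}^n$ made of rectangular cells with side lengths $\boldsymbol{\Delta}\mathbf{x}=(\Delta x_1,\dots,\Delta x_n)$ and diameter $\rho=\|\boldsymbol{\Delta}\mathbf{x}\|_2$; $\Omega_0$ is the cell centred at $\mathbf 0$. The limit $\rho\to0$ is taken with fixed cell aspect ratios ($\boldsymbol{\Delta}\mathbf{x}=\rho\,\mathbf{s}$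 with $\mathbf{s}$ a fixed vector with positive entries), stencils being fixed sets of relative cell indices. $\overline u_i$ is the average of $u$ over the cell $\Omega_i$. Polynomial associated to a stencil: for a finite set $\mathcal S$ of cell indices containing $0$, the polynomial of degree $d$ associated to $\mathcal S$ is the minimizer of $\sum_{i\in\mathcal S}|\langle P\rangle_{\Omega_i}-\overline u_i|^2$ among all $P\in\mathbb{P}^d_n$ with $\langle P\rangle_{\Omega_0}=\overline u_0$, where $\langle P\rangle_{\Omega_i}$ is the average of $P$ over $\Omega_i$ (stencils are such that the minimizer is unique). Jiang–Shu smoothness indicator: for $q\in\mathbb{P}^d_n$, $I[q]=\sum_{1\le|\boldsymbol\beta|\le d}\boldsymbol{\Delta}\mathbf{x}^{2\boldsymbol\beta-\mathbf 1}\int_{\Omega_0}(\partial_{\boldsymbol\beta}q(\mathbf{x}))^2\,d\mathbf{x}$. CWENOZ reconstruction: $P_{\mathrm{opt}}\in\mathbb{P}^G_n$ is associated to a stencil $\mathcal S_{\mathrm{opt}}\ni0$, and $P_1,\dots,P_m\in\mathbb{P}^g_n$ ($m\ge1$, $g<G$) are associated to substencils $\mathcal S_k$ with $0\in\mathcal S_k\subset\mathcal S_{\mathrm{opt}}$. Fix real $d_0,\dots,d_m>0$ with $\sum_{k=0}^m d_k=1$ and real $\lambda_0,\dots,\lambda_m$ with $\sum_{k=0}^m\lambda_k=0$. Set $$P_0=\frac1{d_0}\Bigl(P_{\mathrm{opt}}-\sum_{k=1}^m d_kP_k\Bigr),\quad I_0=I[P_{\mathrm{opt}}],\quad I_k=I[P_k]\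 (k\ge1),\quad \tau=\Bigl|\sum_{k=0}^m\lambda_kI_k\Bigr|,$$ $$\alpha^Z_k=d_k\Bigl(1+\Bigl(\frac{\tau}{I_k+\epsilon}\Bigr)^{\ell}\Bigr),\quad \omega_k=\frac{\alpha^Z_k}{\sum_{i=0}^m\alpha^Z_i},\quad P_{\mathrm{rec}}^{\mathrm{CWZ}}=\sum_{k=0}^m\omega_kP_k,$$ where $\epsilon>0$ and $\ell\ge1$ are parameters. Orders: $\theta(f(\rho))=r$ means $f(\rho)=a_r\rho^r+o(\rho^r)$ as $\rho\to0$ with $a_r\ne0$ (with $\theta(f)=+\infty$ if $f=\mathcal{O}(\rho^r)$ for all $r$). A smooth function $u$ has a critical point of order $n_{cp}$ at $\mathbf 0$ if $\partial_{\boldsymbol\alpha}u(\mathbf 0)=0$ for all $1\le|\boldsymbol\alpha|\le n_{cp}$ and $\partial_{\boldsymbol\alpha}u(\mathbf 0)\ne0$ for some $|\boldsymbol\alpha|=n_{cp}+1$; $n_{cp}=0$ means that the gradient of $u$ at $\mathbf 0$ is nonzero. $\theta(\tau)|_{n_{cp}=0}$ denotes the order of $\tau$ for data with $n_{cp}=0$, i.e. the minimum of $\theta(\tau)$ over smooth functions $u$ with $n_{cp}=0$ at $\mathbf 0$. ''Smooth'' means $C^\infty$ near $\mathbf 0$; constants in $\mathcal{O}$ may depend on $u$. *)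

(* Defs.v *)
From HB Require Import structures.
From mathcomp Require Import all_boot all_order all_algebra finmap.
From mathcomp Require Import all_classical all_reals all_analysis.
From mathcomp Require Import -(notations) mpoly.

Set Implicit Arguments.
Unset Strict Implicit.
Unset Printing Implicit Defensive.

Import Order.TTheory GRing.Theory Num.Theory.
Import numFieldNormedType.Exports.

Local Open Scope classical_set_scope.
Local Open Scope ring_scope.

Section Calculus.
Variables (R : realType) (n : nat).
Implicit Types (f : 'rV[R]_n -> R) (x : 'rV[R]_n).

Definition set_coord x (j : 'I_n) (t : R) : 'rV[R]_n :=
  \row_k (if k == j then t else x 0 k).

(* Volume integral over the box with opposite corners a and b, as an iterated
   one-dimensional Lebesgue integral (there is no Lebesgue measure on 'rV[R]_n
   in the library).  It is only used for integrands that are continuous on the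
   box, where the two coincide by Fubini's theorem.  All coordinates of the
   base point 0 get overwritten. *)
Definition box_integral (a b : 'rV[R]_n) f : R :=
  foldr (fun (j : 'I_n) (F : 'rV[R]_n -> R) x =>
           \int[lebesgue_measure]_(t in `[a 0 j, b 0 j]) F (set_coord x j t))
        f (enum 'I_n) 0.

Definition pderiv (i : 'I_n) f : 'rV[R]_n -> R :=
  fun x => 'D_(delta_mx 0 i) f x.

Definition pderivs (s : seq 'I_n) f : 'rV[R]_n -> R := foldr pderiv f s.

Definition pderivm (a : multinom n) f : 'rV[R]_n -> R :=
  pderivs (flatten [seq nseq (a i) i | i <- enum 'I_n]) f.

(* C^oo in a neighbourhood of 0, the same for all orders: all iterated partial
   derivatives, taken in any order, exist and are continuous. *)
Definition smooth_near0 f : Prop :=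
  \forall x \near (0 : 'rV[R]_n), forall s : seq 'I_n,
    (forall i, derivable (pderivs s f) x (delta_mx 0 i)) /\
    {for x, continuous (pderivs s f)}.

Definition critical_order f (k : nat) : Prop :=
  (forall a : multinom n, (1 <= mdeg a <= k)%N -> pderivm a f 0 = 0) /\
  (exists2 a : multinom n, mdeg a = k.+1 & pderivm a f 0 != 0).

Definition l2norm x : R := Num.sqrt (\sum_(j < n) x 0 j ^+ 2).

End Calculus.

Section Orders.
Variable R : realType.

(* [has_order f r] is theta(f) = r, for rho -> 0 with rho > 0. *)
Definition has_order (f : R -> R) (r : \bar R) : Prop :=
  match r with
  | r'%:E => exists2 c : R, c != 0 &
      (fun rho => f rho - c * rho `^ r') =o_ (0^'+) (fun rho => rho `^ r')
  | +oo%E => forall r' : R, f =O_ (0^'+) (fun rho => rho `^ r')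
  | -oo%E => False
  end.

Definition is_min (A : set (\bar R)) (r : \bar R) : Prop := A r /\ lbound A r.

End Orders.

Section Grid.
Variables (R : realType) (n : nat).
Implicit Types (dx x : 'rV[R]_n) (i : 'rV[int]_n) (q : mpoly n R).

Definition cell_lo dx i : 'rV[R]_n := \row_j (((i 0 j)%:~R - 2^-1) * dx 0 j).
Definition cell_hi dx i : 'rV[R]_n := \row_j (((i 0 j)%:~R + 2^-1) * dx 0 j).

Definition cell dx i : set 'rV[R]_n :=
  [set x | forall j, cell_lo dx i 0 j <= x 0 j <= cell_hi dx i 0 j].

Definition cell_integral dx i (f : 'rV[R]_n -> R) : R :=
  box_integral (cell_lo dx i) (cell_hi dx i) f.

Definition cell_avg dx i (f : 'rV[R]_n -> R) : R :=
  (\prod_j dx 0 j)^-1 * cell_integral dx i f.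

Definition peval q x : R := meval (fun j => x 0 j) q.

Definition mpow dx (e : 'I_n -> int) : R := \prod_j dx 0 j ^ e j.

Definition jiang_shu (d : nat) dx q : R :=
  \sum_(b : bmultinom n d.+1 | (1 <= mdeg b)%N)
    mpow dx (fun j => (2 * b j)%N%:Z - 1) *
    cell_integral dx 0 (fun x => peval (mderivm b q) x ^+ 2).

Definition lsq_residual (S : {fset 'rV[int]_n}) dx (v : 'rV[int]_n -> R) q : R :=
  \sum_(i <- S) `|cell_avg dx i (peval q) - v i| ^+ 2.

Definition lsq_admissible (d : nat) dx (v : 'rV[int]_n -> R) q : Prop :=
  (msize q <= d.+1)%N /\ cell_avg dx 0 (peval q) = v 0.

Definition is_associated (d : nat) (S : {fset 'rV[int]_n}) dx v q : Prop :=
  lsq_admissible d dx v q /\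
  forall q', lsq_admissible d dx v q' ->
    lsq_residual S dx v q <= lsq_residual S dx v q'.

(* Meaningful only when the minimizer is unique, see [Sopt_unique] and
   [Ssub_unique] below. *)
Definition associated_poly (d : nat) (S : {fset 'rV[int]_n}) dx v : mpoly n R :=
  xget 0 [set q | is_associated d S dx v q].

End Grid.

(* The data of a CWENOZ reconstruction that does not depend on the mesh size.
   In families indexed by 'I_m.+1, ord0 refers to P_opt (or P_0) and
   [lift ord0 k] to the lower-degree polynomial number k : 'I_m. *)
Record cwenoz (R : realType) (n m : nat) := Cwenoz {
  aspect : 'rV[R]_n;
  Gdeg : nat;
  gdeg : nat;
  Sopt : {fset 'rV[int]_n};
  Ssub : 'I_m -> {fset 'rV[int]_n};
  dcoef : 'I_m.+1 -> R;
  lcoef : 'I_m.+1 -> R;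
  aspect_gt0 : forall j, 0 < aspect 0 j;
  (* makes rho the diameter of the cells of sizes rho *: aspect *)
  aspect_norm : l2norm aspect = 1;
  gdeg_lt : (gdeg < Gdeg)%N;
  Sopt0 : 0 \in Sopt;
  Ssub0 : forall k, 0 \in Ssub k;
  Ssub_sub : forall k, (Ssub k `<=` Sopt)%fset;
  Sopt_unique : forall rho : R, 0 < rho -> forall v,
    exists! q, is_associated Gdeg Sopt (rho *: aspect) v q;
  Ssub_unique : forall k (rho : R), 0 < rho -> forall v,
    exists! q, is_associated gdeg (Ssub k) (rho *: aspect) v q;
  dcoef_gt0 : forall k, 0 < dcoef k;
  dcoef_sum : \sum_k dcoef k = 1;
  lcoef_sum : \sum_k lcoef k = 0 }.

Section Cwenoz.
Variables (R : realType) (n m : nat) (W : cwenoz R n m).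
Implicit Types (u : 'rV[R]_n -> R) (rho : R) (k : 'I_m.+1).

Definition mesh rho : 'rV[R]_n := rho *: aspect W.

Definition averages u rho : 'rV[int]_n -> R := fun i => cell_avg (mesh rho) i u.

Definition Popt u rho : mpoly n R :=
  associated_poly (Gdeg W) (Sopt W) (mesh rho) (averages u rho).

Definition Plow (k : 'I_m) u rho : mpoly n R :=
  associated_poly (gdeg W) (Ssub W k) (mesh rho) (averages u rho).

Definition Pzero u rho : mpoly n R :=
  (dcoef W ord0)^-1 *:
  (Popt u rho - \sum_(k < m) dcoef W (lift ord0 k) *: Plow k u rho).

Definition Pk k u rho : mpoly n R :=
  if unlift ord0 k is Some j then Plow j u rho else Pzero u rho.

Definition Ik k u rho : R :=
  if unlift ord0 k is Some j then jiang_shu (gdeg W) (mesh rho) (Plow j u rho)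
  else jiang_shu (Gdeg W) (mesh rho) (Popt u rho).

Definition tau u rho : R := `|\sum_k lcoef W k * Ik k u rho|.

Definition alphaZ (eps ell : R) u rho k : R :=
  dcoef W k * (1 + (tau u rho / (Ik k u rho + eps)) `^ ell).

Definition omega (eps ell : R) u rho k : R :=
  alphaZ eps ell u rho k / \sum_i alphaZ eps ell u rho i.

Definition Prec (eps ell : R) u rho : mpoly n R :=
  \sum_k omega eps ell u rho k *: Pk k u rho.

(* |q - u| = O(rho^r) uniformly on the central cell, as rho -> 0+ *)
Definition accuracy (r : nat) u (q : R -> mpoly n R) : Prop :=
  exists C : R, \forall rho \near 0^'+, forall x, cell (mesh rho) 0 x ->
    `|peval (q rho) x - u x| <= C * rho ^+ r.

Definition moment_expansion (M : nat) u (q : R -> mpoly n R) : Prop :=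
  forall a : multinom n, (1 <= mdeg a <= M)%N ->
  (fun rho =>
     mpow (mesh rho) (fun j => (a j)%:Z - 1) *
       cell_integral (mesh rho) 0 (peval (mderivm a (q rho)))
     - \sum_(b : bmultinom n (M - mdeg a).+1 | [forall j, ~~ odd (b j)])
         pderivm (mnm_add a b) u 0 /
           (2 ^+ mdeg b * (\prod_j ((b j).+1)`!)%N%:R) *
         mpow (mesh rho) (fun j => (mnm_add a b j)%:Z))
  =O_ (0^'+) (fun rho => rho ^+ M.+1).

Definition tau_orders_ncp0 : set (\bar R) :=
  [set r | exists u, [/\ smooth_near0 u, critical_order u 0 &
                         has_order (tau u) r]].

End Cwenoz.

(* Main.v *)
Require Import Defs.
From HB Require Import structures.
From mathcomp Require Import all_boot all_order all_algebra finmap.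
From mathcomp Require Import all_classical all_reals all_analysis.
From mathcomp Require Import -(notations) mpoly.
From mathcomp Require Import ring lra zify.

(** The reconstruction error splits as
    [P_rec - u = \sum_k (omega_k - d_k) (P_k - u) + (P_opt - u)], because the
    weights and the [d_k] both sum to 1 ([accuracy_Prec]).  The [P_k] being
    accurate to order [g + 1], it is enough that [omega_k - d_k] is
    O(rho^(G-g)).

    Put [y_k = I_k + epsilon] and [X_k = (tau / y_k)^ell].  The deviation
    [omega_k - d_k] only involves differences [X_k - X_i].  If [X_k] is
    O(rho^(G-g-1)) and the [y_k] agree up to a relative O(rho), these
    differences gain the missing power of [rho] ([nonlinear_weight_close]).

    The size of the [y_k] and of their differences comes from linear algebra.
    In coordinates scaled by the mesh size, the least squares polynomials are
    linear functions of the cell averages on the stencil, with coefficients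
    free of [rho], and they reproduce polynomials of low degree
    ([associated_poly_linear], [associated_poly_avg], [associated_poly_dilate]);
    the Jiang-Shu indicators become quadratic forms in the cell averages
    ([IkE]).  Let [w] be the Taylor polynomial of [u] of degree [g], and [p] the
    least degree of its nonconstant terms.  The averages of [u] are those of [w]
    up to O(rho^(g+1)), and so [I_k] is [J + O(rho^(p+g+1))] with [J] common to
    all [k] ([indicator_expansion]) and at least of the order of [rho^(2p)]
    ([common_indicator_ge]).
    - If [p <= M], then [y_k] is at least of the order of
      [rho^(min(mhat, 2M))], and (c) bounds [X_k], provided that tau is as small
      for [u] as it is for data without critical point.
    - If all terms of degree 1 to [M] vanish, then the [I_k] and tau are
      O(rho^(2M+2)) while [epsilon] is of the order of [rho^mhat]; (a) gives the
      closeness of the [y_k] and (b) bounds [X_k].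

    Critical points do not lower the order of tau ([tau_Opow]): tau is the
    absolute value of a quadratic form, so by the parallelogram law its value at
    a polynomial is controlled by values at polynomials with nonzero gradient;
    for these tau is the absolute value of a polynomial in [rho], so it has an
    order, which is at least the minimal one. *)

Set Implicit Arguments.
Unset Strict Implicit.
Unset Printing Implicit Defensive.

Import Order.TTheory GRing.Theory Num.Theory.
Import numFieldNormedType.Exports.

Local Open Scope classical_set_scope.
Local Open Scope ring_scope.

(** * Integrals over a segment *)

(** The Lebesgue integral is a difference of two suprema over simple functions
    and these are monotone whether or not the functions are measurable.  Hence
    a function trapped between two polynomials stays so, coordinate after
    coordinate, inside an iterated integral. *)
Lemma le_integral_nonmeasurable d (T : measurableType d) (R : realType)
    (mu : {measure set T -> \bar R}) (D : set T) (f g : T -> \bar R) :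
  (forall x, D x -> (f x <= g x)%E) ->
  (\int[mu]_(x in D) f x <= \int[mu]_(x in D) g x)%E.
Proof.
move=> fg.
have nn (h k : T -> \bar R) : (forall x, (0 <= h x)%E) ->
    (forall x, (0 <= k x)%E) -> (forall x, D x -> (h x <= k x)%E) ->
    (\int[mu]_(x in D) h x <= \int[mu]_(x in D) k x)%E.
  move=> h0 k0 hk; rewrite !ge0_integralE//.
  apply: le_ereal_sup => _ [s /= sh <-]; exists s => //= x.
  apply: le_trans (sh x) _; rewrite /patch; case: ifPn => // /set_mem; exact: hk.
rewrite integralE [leRHS]integralE; apply: leeB; apply: nn.
- by move=> x; exact: funepos_ge0.
- by move=> x; exact: funepos_ge0.
- by move=> x /mem_set; apply: funepos_le => y; rewrite inE; exact: fg.
- by move=> x; exact: funeneg_ge0.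
- by move=> x; exact: funeneg_ge0.
- by move=> x /mem_set; apply: funeneg_le => y; rewrite inE; exact: fg.
Qed.

Section SegmentIntegral.
Variable R : realType.
Implicit Types (a b : R) (f : R -> R) (p : {poly R}).
Local Notation mu := (@lebesgue_measure R).

Definition monomial_integral a b (k : nat) : R :=
  (b ^+ k.+1 - a ^+ k.+1) / k.+1%:R.

Lemma integrable_segment_poly a b p :
  mu.-integrable `[a, b] (EFin \o horner p).
Proof.
apply: continuous_compact_integrable; first exact: segment_compact.
by apply: continuous_subspaceT; exact: continuous_horner.
Qed.

Lemma segment_integral_poly a b (I : Type) (r : seq I) (c : I -> R)
    (k : I -> nat) (p := \sum_(i <- r) c i *: 'X^(k i)) : a < b ->
  \int[mu]_(t in `[a, b]) p.[t] = \sum_(i <- r) c i * monomial_integral a b (k i).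
Proof.
move=> ab; pose P : {poly R} := \sum_(i <- r) (c i / (k i).+1%:R) *: 'X^((k i).+1).
have Pp : P^`() = p.
  rewrite /P raddf_sum /=; apply: eq_bigr => i _.
  rewrite derivZ derivXn /= -scalerMnr scalerMnl -(mulr_natr (c i / _)).
  by rewrite mulfVK ?pnatr_eq0.
have PE t : P.[t] = \sum_(i <- r) c i * (t ^+ (k i).+1 / (k i).+1%:R).
  rewrite horner_sum; apply: eq_bigr => i _.
  by rewrite hornerZ hornerXn mulrAC mulrA.
rewrite /Rintegral (@continuous_FTC2 _ (horner p) (horner P)) //.
- rewrite /= !PE -sumrB; apply: eq_bigr => i _.
  by rewrite -mulrBr -mulrBl.
- by apply: continuous_subspaceT; exact: continuous_horner.
- split; [by move=> x _; exact: derivable_horner| |].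
  + by apply: cvg_at_right_filter; exact: continuous_horner.
  + by apply: cvg_at_left_filter; exact: continuous_horner.
- by move=> x _; rewrite -derivE Pp.
Qed.

(** The bounds [p - c] and [p + c] are integrable, so the integral of an
    arbitrary [f] between them is finite and [fine] loses nothing. *)
Lemma segment_integral_near a b f p (c : R) : a <= b ->
  (forall t, a <= t <= b -> `|f t - p.[t]| <= c) ->
  `|\int[mu]_(t in `[a, b]) f t - \int[mu]_(t in `[a, b]) p.[t]| <= c * (b - a).
Proof.
move=> ab fp.
have D : measurable (`[a, b]%classic : set R) by [].
have ip k : (\int[mu]_(t in `[a, b]) (p + k%:P).[t]%:E =
    (\int[mu]_(t in `[a, b]) p.[t] + k * (b - a))%:E)%E.
  have ik := integrable_segment_poly a b (p + k%:P).
  rewrite -[LHS]fineK; last exact: integrable_fin_num.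
  congr EFin; under eq_integral do rewrite hornerD hornerC.
  rewrite -/(Rintegral _ _ _) RintegralD//; last 2 first.
  - exact: integrable_segment_poly.
  - have := integrable_segment_poly a b k%:P.
    by congr (_.-integrable _ _); apply/funext => x /=; rewrite hornerC.
  rewrite Rintegral_cst//; congr (_ + _ * _).
  rewrite /= lebesgue_measure_itv/= lte_fin; case: ltP => // ba.
  by rewrite (@le_anti _ _ a b) ?subrr// ab.
have lo : ((\int[mu]_(t in `[a, b]) p.[t] - c * (b - a))%:E <=
    \int[mu]_(t in `[a, b]) (f t)%:E)%E.
  rewrite -mulNr -ip; apply: le_integral_nonmeasurable => t.
  rewrite /= in_itv/= => /fp; rewrite lee_fin hornerD hornerC ler_norml; lra.
have hi : (\int[mu]_(t in `[a, b]) (f t)%:E <=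
    (\int[mu]_(t in `[a, b]) p.[t] + c * (b - a))%:E)%E.
  rewrite -ip; apply: le_integral_nonmeasurable => t.
  rewrite /= in_itv/= => /fp; rewrite lee_fin hornerD hornerC ler_norml; lra.
move: lo hi; move: (\int[mu]_(t in `[a, b]) p.[t]) => q.
rewrite /Rintegral; case: (integral _ _ _) => [r||] //=.
rewrite !lee_fin ler_norml => lo hi; lra.
Qed.

End SegmentIntegral.

(** * Polynomials and box integrals *)

Section MonomialExtension.
Variables (R : realType) (n : nat).
Implicit Types (q : mpoly n R) (F : multinom n -> R) (c : R).

(** A linear functional on polynomials is determined by its values on the
    monomials; averages over cells are handled in this form. *)
Definition extend_monomials F q : R :=
  \sum_(m <- msupp q) mcoeff m q * F m.

Lemma extend_monomialsE F q (s : seq (multinom n)) : uniq s ->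
  {subset msupp q <= s} -> extend_monomials F q = \sum_(m <- s) mcoeff m q * F m.
Proof.
move=> us qs; rewrite [RHS](bigID (mem (msupp q)))/= [X in _ + X]big1 ?addr0.
  rewrite -big_filter; apply: perm_big; apply: uniq_perm.
  - exact: msupp_uniq.
  - exact: filter_uniq.
  - by move=> m; rewrite mem_filter /=; case: (boolP (m \in msupp q)) => // /qs ->.
by move=> m; rewrite -mcoeff_eq0 => /eqP ->; rewrite mul0r.
Qed.

Fact extend_monomials_is_linear F : linear_for *%R (extend_monomials F).
Proof.
move=> c p q; pose s := undup (msupp (c *: p + q) ++ msupp p ++ msupp q).
have us : uniq s by exact: undup_uniq.
rewrite !(@extend_monomialsE F _ s)//; last 3 first.
- by move=> m mq; rewrite mem_undup !mem_cat mq !orbT.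
- by move=> m mp; rewrite mem_undup !mem_cat mp !orbT.
- by move=> m mpq; rewrite mem_undup !mem_cat mpq.
rewrite mulr_sumr -big_split /=; apply: eq_bigr => m _.
by rewrite mcoeffD mcoeffZ mulrDl mulrA.
Qed.

HB.instance Definition _ F := GRing.isLinear.Build R (mpoly n R) R *%R
  (extend_monomials F) (extend_monomials_is_linear F).

Lemma extend_monomialsX F m : extend_monomials F (mpolyX R m) = F m.
Proof. by rewrite /extend_monomials msuppX big_seq1 mcoeffX eqxx mul1r. Qed.

(** The polynomial [x |-> q (c x)]: passing from physical coordinates to those
    scaled by the mesh size. *)
Definition dilate c q : mpoly n R :=
  \sum_(m <- msupp q) (mcoeff m q * c ^+ mdeg m) *: mpolyX R m.

Lemma mcoeff_dilate c q m : mcoeff m (dilate c q) = c ^+ mdeg m * mcoeff m q.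
Proof.
rewrite raddf_sum /=.
rewrite (eq_bigr (fun k => mcoeff k q * (c ^+ mdeg k * (k == m)%:R))); last first.
  by move=> k _; rewrite mcoeffZ mcoeffX mulrA.
have [mq|mq] := boolP (m \in msupp q).
  rewrite (bigD1_seq m) ?msupp_uniq//= eqxx mulr1 big1 ?addr0 1?mulrC// => k km.
  by rewrite (negbTE km) !mulr0.
rewrite (memN_msupp_eq0 mq) mulr0 big_seq big1// => k kq.
by case: eqP kq => [->|]; rewrite ?(negbTE mq) // !mulr0.
Qed.

Fact dilate_is_linear c : linear (dilate c).
Proof.
move=> a p q; apply/mpolyP => m.
by rewrite !(mcoeffD, mcoeffZ, mcoeff_dilate) mulrDr mulrCA.
Qed.

HB.instance Definition _ c := GRing.isLinear.Build R (mpoly n R) (mpoly n R) *:%R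
  (dilate c) (dilate_is_linear c).

Lemma dilateX c m : dilate c (mpolyX R m) = c ^+ mdeg m *: mpolyX R m.
Proof. by rewrite /dilate msuppX big_seq1 mcoeffX eqxx mul1r. Qed.

Lemma dilateK c q : c != 0 -> dilate c (dilate c^-1 q) = q.
Proof.
move=> c0; apply/mpolyP => m; rewrite !mcoeff_dilate mulrA -exprMn divff//.
by rewrite expr1n mul1r.
Qed.

Lemma msize_leP q k : reflect (forall m, (k <= mdeg m)%N -> mcoeff m q = 0)
  (msize q <= k)%N.
Proof.
apply: (iffP idP) => [qk m km|qk].
  by apply/eqP; rewrite mcoeff_eq0; apply: msize_mdeg_ge; exact: leq_trans km.
rewrite mmeasureE big_seq; apply/bigmax_leqP_seq => m mq _.
by rewrite ltnNge; apply/negP => /qk /eqP; rewrite mcoeff_eq0 mq.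
Qed.

Lemma msize_dilate c q k : (msize q <= k)%N -> (msize (dilate c q) <= k)%N.
Proof.
by move=> /msize_leP qk; apply/msize_leP => m /qk; rewrite mcoeff_dilate => ->; rewrite mulr0.
Qed.

Lemma extend_monomials_dilate F c q :
  extend_monomials F (dilate c q) =
  extend_monomials (fun m => c ^+ mdeg m * F m) q.
Proof.
rewrite (@extend_monomialsE _ _ (msupp q)) ?msupp_uniq//.
  by apply: eq_bigr => m _; rewrite mcoeff_dilate mulrCA mulrA.
by move=> m; apply: contraTT => /memN_msupp_eq0 mq; rewrite -mcoeff_eq0 mcoeff_dilate mq mulr0.
Qed.

Lemma peval_dilate c q (x : 'rV[R]_n) : peval (dilate c q) x = peval q (c *: x).
Proof.
have pE r y : peval r y = extend_monomials (fun m => \prod_j y 0 j ^+ m j) r.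
  by rewrite /peval mevalE.
rewrite !pE extend_monomials_dilate; congr extend_monomials.
apply/funext => m; under [RHS]eq_bigr do rewrite mxE exprMn.
by rewrite big_split/= prodrXr mdegE.
Qed.

End MonomialExtension.

Section BoxIntegral.
Variables (R : realType) (n : nat) (a b : 'rV[R]_n).
Hypothesis ab : forall j, a 0 j < b 0 j.
Implicit Types (f : 'rV[R]_n -> R) (x : 'rV[R]_n) (q : mpoly n R).

(** The box integral with only the coordinates in [js] integrated out: the
    induction on the list of coordinates runs through these functions. *)
Definition partial_integral (js : seq 'I_n) f : 'rV[R]_n -> R :=
  foldr (fun (j : 'I_n) (F : 'rV[R]_n -> R) x =>
    \int[lebesgue_measure]_(t in `[a 0 j, b 0 j]) F (set_coord x j t)) f js.

(** Integrating out one more coordinate replaces, in each monomial, the power of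
    that coordinate by a number. *)
Lemma partial_integral_peval js q x : uniq js ->
  partial_integral js (peval q) x =
  \sum_(m <- msupp q) mcoeff m q * \prod_j (if j \in js
      then monomial_integral (a 0 j) (b 0 j) (m j) else x 0 j ^+ m j).
Proof.
elim: js x => [|j js ih] x /=; first by rewrite /partial_integral /= /peval mevalE.
move=> /andP[jjs ujs].
pose rest (m : multinom n) := \prod_(l | l != j) (if l \in js
  then monomial_integral (a 0 l) (b 0 l) (m l) else x 0 l ^+ m l).
rewrite -/(partial_integral js _).
pose p : {poly R} :=
  \sum_(m <- msupp q) (mcoeff m q * rest m) *: 'X^((m : multinom n) j).
under eq_Rintegral => t _.
  rewrite (ih _ ujs).
  rewrite (_ : \sum_(m <- _) _ = p.[t]); first over.
  rewrite horner_sum; apply: eq_bigr => m _.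
  rewrite hornerZ hornerXn -mulrA; congr (_ * _).
  rewrite (bigD1 j)//= (negbTE jjs) mxE eqxx mulrC; congr (_ * _).
  by apply: eq_bigr => l lj; rewrite mxE (negbTE lj).
rewrite segment_integral_poly//; apply: eq_bigr => m _.
rewrite -mulrA; congr (_ * _); rewrite [RHS](bigD1 j)//= inE eqxx mulrC.
by congr (_ * _); apply: eq_bigr => l lj; rewrite inE (negbTE lj).
Qed.

Lemma box_integral_peval q : box_integral a b (peval q) =
  extend_monomials
    (fun m => \prod_j monomial_integral (a 0 j) (b 0 j) (m j)) q.
Proof.
rewrite /box_integral -/(partial_integral _ _) partial_integral_peval ?enum_uniq//.
apply: eq_bigr => m _; congr (_ * _).
by apply: eq_bigr => j _; rewrite mem_enum.
Qed.

Lemma box_integral_ge0 f : (forall x, 0 <= f x) -> 0 <= box_integral a b f.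
Proof.
move=> f0; rewrite /box_integral; elim: (enum _) (0 : 'rV[R]_n) => [|j js ih] x //=.
apply: Rintegral_ge0 => t _; exact: ih.
Qed.

(** In each coordinate the integral of the polynomial is again a polynomial,
    so that the one-dimensional estimate applies to the coordinates in turn. *)
Lemma partial_integral_near js f q (c : R) x : uniq js ->
  (forall y : 'rV[R]_n, (forall j, a 0 j <= y 0 j <= b 0 j) -> `|f y - peval q y| <= c) ->
  (forall j, j \notin js -> a 0 j <= x 0 j <= b 0 j) ->
  `|partial_integral js f x - partial_integral js (peval q) x| <=
  c * \prod_(j <- js) (b 0 j - a 0 j).
Proof.
move=> + fq; elim: js x => [|j js ih] x /=.
  by move=> _ xab; rewrite big_nil mulr1; apply: fq => j; apply: xab.
move=> /andP[jjs ujs] xab; rewrite big_cons mulrCA mulrC.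
pose rest (m : multinom n) := \prod_(l | l != j) (if l \in js
  then monomial_integral (a 0 l) (b 0 l) (m l) else x 0 l ^+ m l).
pose p : {poly R} :=
  \sum_(m <- msupp q) (mcoeff m q * rest m) *: 'X^((m : multinom n) j).
have pE t : partial_integral js (peval q) (set_coord x j t) = p.[t].
  rewrite (partial_integral_peval _ _ ujs).
  rewrite horner_sum; apply: eq_bigr => m _.
  rewrite hornerZ hornerXn -mulrA; congr (_ * _).
  rewrite (bigD1 j)//= (negbTE jjs) mxE eqxx mulrC; congr (_ * _).
  by apply: eq_bigr => l lj; rewrite mxE (negbTE lj).
rewrite -/(partial_integral js _) -/(partial_integral js _).
under [X in _ - X]eq_Rintegral do rewrite pE.
apply: segment_integral_near; first exact: ltW.
move=> t tab; rewrite -pE; apply: ih => // l ljs; rewrite mxE.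
by case: eqP => [->//|/eqP lj]; apply: xab; rewrite inE negb_or lj.
Qed.

Lemma box_integral_near f q (c : R) :
  (forall y : 'rV[R]_n, (forall j, a 0 j <= y 0 j <= b 0 j) -> `|f y - peval q y| <= c) ->
  `|box_integral a b f - box_integral a b (peval q)| <=
  c * \prod_j (b 0 j - a 0 j).
Proof.
move=> fq; rewrite (_ : \prod_j _ = \prod_(j <- enum 'I_n) (b 0 j - a 0 j)).
  2: by rewrite big_enum.
apply: partial_integral_near => //; first exact: enum_uniq.
by move=> j; rewrite mem_enum.
Qed.

End BoxIntegral.

(** * Cell averages *)

Section CellAverages.
Variables (R : realType) (n : nat).
Implicit Types (dx : 'rV[R]_n) (i : 'rV[int]_n) (q : mpoly n R) (f : 'rV[R]_n -> R).

Definition poly_avg dx i : mpoly n R -> R :=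
  extend_monomials (fun m => (\prod_j dx 0 j)^-1 *
    \prod_j monomial_integral (cell_lo dx i 0 j) (cell_hi dx i 0 j) (m j)).

HB.instance Definition _ dx i := GRing.Linear.on (poly_avg dx i).

Lemma cell_lo_lt_hi dx i : (forall j, 0 < dx 0 j) ->
  forall j, cell_lo dx i 0 j < cell_hi dx i 0 j.
Proof. by move=> dx0 j; rewrite !mxE ltr_pM2r// ltrD2l gtrN// invr_gt0. Qed.

Lemma cell_hi_sub_lo dx i j : cell_hi dx i 0 j - cell_lo dx i 0 j = dx 0 j.
Proof. by rewrite !mxE; field. Qed.

Lemma cell_integralE dx i f : (forall j, 0 < dx 0 j) ->
  cell_integral dx i f = \prod_j dx 0 j * cell_avg dx i f.
Proof.
move=> dx0; rewrite /cell_avg mulrA mulfV ?mul1r// gt_eqF//.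
by rewrite prodr_gt0.
Qed.

Lemma cell_avg_peval dx i q : (forall j, 0 < dx 0 j) ->
  cell_avg dx i (peval q) = poly_avg dx i q.
Proof.
move=> dx0; rewrite /cell_avg /cell_integral box_integral_peval; last first.
  exact: cell_lo_lt_hi.
by rewrite mulr_sumr; apply: eq_bigr => m _; rewrite mulrCA.
Qed.

Lemma cell_avg_near dx i f q (c : R) : (forall j, 0 < dx 0 j) ->
  (forall x, cell dx i x -> `|f x - peval q x| <= c) ->
  `|cell_avg dx i f - poly_avg dx i q| <= c.
Proof.
move=> dx0 fq; rewrite -cell_avg_peval// /cell_avg -mulrBr normrM.
have P0 : 0 < \prod_j dx 0 j by rewrite prodr_gt0.
rewrite gtr0_norm ?invr_gt0// mulrC ler_pdivrMr//.
have := box_integral_near (cell_lo_lt_hi i dx0) fq.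
by under eq_bigr do rewrite cell_hi_sub_lo.
Qed.

Lemma poly_avg_sqr_ge0 dx i q : (forall j, 0 < dx 0 j) ->
  0 <= poly_avg dx i (q ^+ 2).
Proof.
move=> dx0; rewrite -cell_avg_peval// mulr_ge0//.
  by rewrite invr_ge0 prodr_ge0// => j _; exact: ltW.
by apply: box_integral_ge0 => x; rewrite /peval rmorphXn sqr_ge0.
Qed.

Lemma poly_avgC dx i (c : R) : (forall j, 0 < dx 0 j) ->
  poly_avg dx i (mpolyC n c) = c.
Proof.
move=> dx0; rewrite -alg_mpolyC linearZ /= -[RHS]mulr1 -(mpolyX0 n R).
congr (_ * _); rewrite /poly_avg extend_monomialsX.
rewrite [X in _ * X](eq_bigr (fun j => dx 0 j)) => [|j _].
  by rewrite mulVf// gt_eqF// prodr_gt0.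
by rewrite /monomial_integral mnm0E !expr1 divr1 cell_hi_sub_lo.
Qed.

(** The variance [avg ((q - avg q) ^ 2)] is nonnegative. *)
Lemma poly_avg_variance dx i q : (forall j, 0 < dx 0 j) ->
  poly_avg dx i q ^+ 2 <= poly_avg dx i (q ^+ 2).
Proof.
move=> dx0; set c := poly_avg dx i q.
have := poly_avg_sqr_ge0 i (q - mpolyC n c) dx0.
rewrite sqrrB [X in _ + X]expr2 -mpolyCM (mulrC q) mul_mpolyC -/c.
rewrite !(linearD, linearN, linearMn, linearZ) /= -/c -expr2 poly_avgC//.
change (c *: - c) with (c * - c); rewrite !expr2; lra.
Qed.

Lemma poly_avg_dilate dx i q (c : R) : c != 0 ->
  poly_avg (c *: dx) i q = poly_avg dx i (dilate c q).
Proof.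
move=> c0; rewrite /poly_avg extend_monomials_dilate.
congr extend_monomials; apply/funext => m.
have -> : \prod_j (c *: dx) 0 j = c ^+ n * \prod_j dx 0 j.
  by under eq_bigr do rewrite mxE; rewrite big_split /= prodr_const card_ord.
have -> : \prod_j monomial_integral (cell_lo (c *: dx) i 0 j)
    (cell_hi (c *: dx) i 0 j) (m j) = c ^+ n * c ^+ mdeg m * 
    \prod_j monomial_integral (cell_lo dx i 0 j) (cell_hi dx i 0 j) (m j).
  rewrite mdegE -prodrXr -{1}[n in c ^+ n]card_ord -prodr_const -!big_split/=.
  apply: eq_bigr => j _; rewrite /monomial_integral !mxE -exprS !(mulrCA _ c).
  by rewrite !(exprMn _ c) -mulrBr mulrA.
rewrite invfM; move: (\prod_j dx 0 j)^-1 (expf_neq0 n c0) => P.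
by move: (c ^+ n) => d d0; field.
Qed.

(** [dilate] is multiplicative; evaluating both sides as functions avoids an
    expansion in monomials. *)
Lemma poly_avg_dilateM dx i p q (c : R) : (forall j, 0 < dx 0 j) ->
  poly_avg dx i (dilate c (p * q)) = poly_avg dx i (dilate c p * dilate c q).
Proof.
move=> dx0; rewrite -!cell_avg_peval//; congr cell_avg.
apply/funext => x; rewrite peval_dilate /peval !rmorphM /=.
by rewrite -!/(peval _ _) !peval_dilate.
Qed.

End CellAverages.

(** * Least squares polynomials *)

Section LeastSquares.
Variables (R : realType) (n d : nat) (S : {fset 'rV[int]_n}).
Implicit Types (dx : 'rV[R]_n) (v : 'rV[int]_n -> R) (q h : mpoly n R).

Lemma quadratic_min0 (a b : R) : 0 <= b ->
  (forall t, 0 <= t * (2 * a) + t ^+ 2 * b) -> a = 0.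
Proof.
move=> b0 /(_ (- a / (b + 1))) h; apply/eqP; rewrite -sqrf_eq0 eq_le sqr_ge0.
have b1 : 0 < b + 1 by lra.
rewrite andbT -(pmulr_rle0 _ (_ : 0 < (b + 2) / (b + 1) ^+ 2)); last first.
  by rewrite divr_gt0 ?exprn_gt0//; lra.
rewrite -oppr_ge0; congr (0 <= _): h; field; lra.
Qed.

(** The normal equations of the constrained least squares problem.  Unlike the
    minimality they are linear in the pair of data and minimizer. *)
Lemma is_associatedP dx v q : (forall j, 0 < dx 0 j) ->
  is_associated d S dx v q <->
  [/\ (msize q <= d.+1)%N, poly_avg dx 0 q = v 0 &
    forall h, (msize h <= d.+1)%N -> poly_avg dx 0 h = 0 ->
      \sum_(i <- S) (poly_avg dx i q - v i) * poly_avg dx i h = 0].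
Proof.
move=> dx0.
have resE p : lsq_residual S dx v p = \sum_(i <- S) (poly_avg dx i p - v i) ^+ 2.
  by apply: eq_bigr => i _; rewrite cell_avg_peval// real_normK ?num_real.
have resD p h : lsq_residual S dx v (p + h) = lsq_residual S dx v p +
    2 * (\sum_(i <- S) (poly_avg dx i p - v i) * poly_avg dx i h) +
    \sum_(i <- S) poly_avg dx i h ^+ 2.
  rewrite !resE mulr_sumr -!big_split /=; apply: eq_bigr => i _.
  by rewrite linearD /=; ring.
rewrite /is_associated /lsq_admissible cell_avg_peval//; split.
- move=> [[sq aq] qmin]; split=> // h sh ah.
  apply: (@quadratic_min0 _ (\sum_(i <- S) poly_avg dx i h ^+ 2)).
    by apply: sumr_ge0 => i _; exact: sqr_ge0.
  move=> t; have := qmin (q + t *: h); rewrite resD cell_avg_peval//.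
  rewrite linearD linearZ /= ah mulr0 addr0.
  have -> : \sum_(i <- S) (poly_avg dx i q - v i) * poly_avg dx i (t *: h) =
      t * \sum_(i <- S) (poly_avg dx i q - v i) * poly_avg dx i h.
    by rewrite mulr_sumr; apply: eq_bigr => i _; rewrite linearZ /= mulrCA.
  have -> : \sum_(i <- S) poly_avg dx i (t *: h) ^+ 2 =
      t ^+ 2 * \sum_(i <- S) poly_avg dx i h ^+ 2.
    by rewrite mulr_sumr; apply: eq_bigr => i _; rewrite linearZ /= exprMn.
  rewrite -addrA lerDl mulrCA; apply; split=> //.
  apply/msize_leP => m dm; rewrite mcoeffD mcoeffZ.
  by move/msize_leP: sq => /(_ _ dm) ->; move/msize_leP: sh => /(_ _ dm) ->; rewrite mulr0 addr0.
- move=> [sq aq normal]; split=> // q' []; rewrite cell_avg_peval// => sq' aq'.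
  rewrite -(subrKC q q') resD normal; last 2 first.
  + apply/msize_leP => m dm; rewrite mcoeffB.
    by move/msize_leP: sq => /(_ _ dm) ->; move/msize_leP: sq' => /(_ _ dm) ->; rewrite subrr.
  + by rewrite linearB /= aq aq' subrr.
  by rewrite mulr0 addr0 lerDl; apply: sumr_ge0 => i _; exact: sqr_ge0.
Qed.

Lemma is_associated_linear dx v v' q q' (c : R) : (forall j, 0 < dx 0 j) ->
  is_associated d S dx v q -> is_associated d S dx v' q' ->
  is_associated d S dx (fun i => c * v i + v' i) (c *: q + q').
Proof.
move=> dx0 /is_associatedP [] // sq aq nq /is_associatedP [] // sq' aq' nq'.
apply/is_associatedP => //; split.
- apply/msize_leP => m dm; rewrite mcoeffD mcoeffZ.
  by move/msize_leP: sq => /(_ _ dm) ->; move/msize_leP: sq' => /(_ _ dm) ->; rewrite mulr0 addr0.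
- by rewrite linearP /= aq aq'.
- move=> h sh ah; transitivity (c * (\sum_(i <- S) (poly_avg dx i q - v i) * poly_avg dx i h)
      + \sum_(i <- S) (poly_avg dx i q' - v' i) * poly_avg dx i h); last first.
    by rewrite nq// nq'// mulr0 addr0.
  rewrite mulr_sumr -big_split /=.
  by apply: eq_bigr => i _; rewrite linearP /=; ring.
Qed.

Lemma is_associated_local dx v v' q : 0 \in S -> {in S, v =1 v'} ->
  is_associated d S dx v q -> is_associated d S dx v' q.
Proof.
move=> S0 vv' [[sq aq] qmin].
have rE p : lsq_residual S dx v' p = lsq_residual S dx v p.
  by rewrite /lsq_residual !big_seq; apply: eq_bigr => i /vv' ->.
split; first by split; rewrite -?vv'.
by move=> p [sp ap]; rewrite !rE; apply: qmin; split; rewrite ?vv'.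
Qed.

(** The averages of [q] are matched by [q] itself with zero residual. *)
Lemma is_associated_poly_avg dx q : (forall j, 0 < dx 0 j) ->
  (msize q <= d.+1)%N -> is_associated d S dx (fun i => poly_avg dx i q) q.
Proof.
move=> dx0 sq; apply/is_associatedP => //; split=> // h _ _.
by apply: big1 => i _; rewrite subrr mul0r.
Qed.

Lemma is_associated_dilate dx v q (c : R) : 0 < c -> (forall j, 0 < dx 0 j) ->
  is_associated d S (c *: dx) v q -> is_associated d S dx v (dilate c q).
Proof.
move=> c0 dx0.
have cdx0 j : 0 < (c *: dx) 0 j by rewrite mxE mulr_gt0.
move=> /is_associatedP [] // sq aq nq.
apply/is_associatedP => //; split.
- exact: msize_dilate.
- by rewrite -poly_avg_dilate ?gt_eqF.
- move=> h sh ah; rewrite -[RHS](nq (dilate c^-1 h)).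
  + apply: eq_bigr => i _.
    by rewrite !poly_avg_dilate ?gt_eqF// dilateK ?gt_eqF.
  + exact: msize_dilate.
  + by rewrite poly_avg_dilate ?gt_eqF// dilateK ?gt_eqF.
Qed.

End LeastSquares.

Section AssociatedPolynomial.
Variables (R : realType) (n d : nat) (S : {fset 'rV[int]_n}) (dx : 'rV[R]_n).
Hypothesis dx0 : forall j, 0 < dx 0 j.
Hypothesis S0 : 0 \in S.
Hypothesis uniq_assoc : forall (rho : R), 0 < rho -> forall v,
  exists! q, is_associated d S (rho *: dx) v q.
Implicit Types (v : 'rV[int]_n -> R) (q : mpoly n R).
Local Notation L := (associated_poly d S dx).

Let uniq1 v : exists! q, is_associated d S dx v q.
Proof. by have := uniq_assoc ltr01 v; rewrite scale1r. Qed.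

Lemma associated_polyE v q : is_associated d S dx v q -> L v = q.
Proof.
have [q' [q'P uq'] qP] := uniq1 v.
have Lv : is_associated d S dx v (L v) by apply: xgetPex; exists q'.
by rewrite -(uq' _ qP) -(uq' _ Lv).
Qed.

Lemma associated_polyP v : is_associated d S dx v (L v).
Proof. by have [q' [q'P uq']] := uniq1 v; rewrite (associated_polyE q'P). Qed.

Lemma associated_poly_linear c v v' :
  L (fun i => c * v i + v' i) = c *: L v + L v'.
Proof.
apply: associated_polyE.
by apply: is_associated_linear => //; exact: associated_polyP.
Qed.

Lemma associated_poly_local v v' : {in S, v =1 v'} -> L v = L v'.
Proof.
move=> vv'; apply: associated_polyE.
apply: (@is_associated_local _ _ _ _ _ v') => //.
  by move=> i /vv'.
exact: associated_polyP.
Qed.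

Lemma associated_poly_avg q : (msize q <= d.+1)%N ->
  L (fun i => poly_avg dx i q) = q.
Proof. by move=> sq; apply: associated_polyE; exact: is_associated_poly_avg. Qed.

(** The minimizer on the grid of mesh size [rho] is a rescaling of the minimizer
    for the same data on the reference grid. *)
Lemma associated_poly_dilate rho v : 0 < rho ->
  dilate rho (associated_poly d S (rho *: dx) v) = L v.
Proof.
move=> r0; apply/esym/associated_polyE/is_associated_dilate => //.
by have [q' [q'P _]] := uniq_assoc r0 v; apply: xgetPex; exists q'.
Qed.

End AssociatedPolynomial.

(** * Orders in the mesh size *)

Section OrderCalculus.
Variable R : realType.
Implicit Types (f g : R -> R) (r c : R).

(** [f] is O(rho^r) as [rho] tends to 0 from the right, for real [r]. *)
Definition Opow f r : Prop :=
  exists C, \forall rho \near 0^'+, `|f rho| <= C * rho `^ r.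

Lemma near0_le1 : \forall rho \near (0 : R)^'+, 0 < rho <= 1.
Proof.
near=> rho; apply/andP; split; first by near: rho; exact: nbhs_right_gt.
by near: rho; apply: nbhs_right_le; exact: ltr01.
Unshelve. all: by end_near. Qed.

Lemma OpowP f r : Opow f r ->
  exists2 C, 0 < C & \forall rho \near 0^'+, `|f rho| <= C * rho `^ r.
Proof.
move=> [C fC]; exists (`|C| + 1); first by rewrite ltr_wpDl.
near=> rho; apply: le_trans (_ : C * rho `^ r <= _); first by near: rho.
by rewrite ler_wpM2r ?powR_ge0// (le_trans (ler_norm C))// lerDl.
Unshelve. all: by end_near. Qed.

Lemma Opow_near f g r : (\forall rho \near 0^'+, f rho = g rho) ->
  Opow f r -> Opow g r.
Proof.
move=> fg [C fC]; exists C; near=> rho.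
by rewrite -(near fg rho)//; near: rho.
Unshelve. all: by end_near. Qed.

Lemma Opow_le f g r : (\forall rho \near 0^'+, `|f rho| <= `|g rho|) ->
  Opow g r -> Opow f r.
Proof.
move=> fg [C gC]; exists C; near=> rho.
apply: (le_trans (near fg rho _)) => //; by near: rho.
Unshelve. all: by end_near. Qed.

Lemma OpowW f r r' : r' <= r -> Opow f r -> Opow f r'.
Proof.
move=> r'r /OpowP[C C0 fC]; exists C; near=> rho.
apply: le_trans (near fC rho _) _ => //; rewrite ler_pM2l//.
by apply: ger_powR => //; near: rho; exact: near0_le1.
Unshelve. all: by end_near. Qed.

Lemma Opow0 r : Opow (fun=> 0) r.
Proof. by exists 0; near=> rho; rewrite normr0 mul0r. Unshelve. all: by end_near. Qed.

Lemma OpowD f g r : Opow f r -> Opow g r -> Opow (fun rho => f rho + g rho) r.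
Proof.
move=> [C fC] [D gD]; exists (C + D); near=> rho.
rewrite mulrDl (le_trans (ler_normD _ _))// lerD//; by near: rho.
Unshelve. all: by end_near. Qed.

Lemma OpowM f g r r' : Opow f r -> Opow g r' ->
  Opow (fun rho => f rho * g rho) (r + r').
Proof.
move=> [C fC] [D gD]; exists (C * D); near=> rho.
have rho0 : 0 < rho by near: rho; exact: nbhs_right_gt.
have -> : rho `^ (r + r') = rho `^ r * rho `^ r'.
  by rewrite powRD// (gt_eqF rho0) implybT.
rewrite normrM mulrACA ler_pM//; by near: rho.
Unshelve. all: by end_near. Qed.

Lemma Opow_cst c : Opow (fun=> c) 0.
Proof.
by exists `|c|; near=> rho; rewrite powRr0 mulr1.
Unshelve. all: by end_near. Qed.

Lemma OpowZ c f r : Opow f r -> Opow (fun rho => c * f rho) r.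
Proof. by move=> fr; rewrite -[r]add0r; apply: OpowM => //; exact: Opow_cst. Qed.

Lemma OpowN f r : Opow f r -> Opow (fun rho => - f rho) r.
Proof. by move=> [C fC]; exists C; under eq_near do rewrite normrN. Qed.

Lemma OpowB f g r : Opow f r -> Opow g r -> Opow (fun rho => f rho - g rho) r.
Proof. by move=> fr gr; apply: OpowD => //; exact: OpowN. Qed.

Lemma Opow_norm f r : Opow f r -> Opow (fun rho => `|f rho|) r.
Proof. by move=> [C fC]; exists C; under eq_near do rewrite normr_id. Qed.

Lemma Opow_sum (I : eqType) (s : seq I) (P : pred I) (F : I -> R -> R) r :
  (forall i, i \in s -> P i -> Opow (F i) r) ->
  Opow (fun rho => \sum_(i <- s | P i) F i rho) r.
Proof.
elim: s => [|i s ih] Fr.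
  by under eq_fun do rewrite big_nil; exact: Opow0.
under eq_fun do rewrite big_cons.
have h : Opow (fun rho => \sum_(j <- s | P j) F j rho) r.
  by apply: ih => j js; apply: Fr; rewrite inE js orbT.
case: (boolP (P i)) => [Pi|_] //; apply: OpowD => //.
by apply: Fr => //; exact: mem_head.
Qed.

Lemma Opow_exp k : Opow (fun rho => rho ^+ k) k%:R.
Proof.
exists 1; near=> rho; rewrite mul1r.
have rho0 : 0 < rho by near: rho; exact: nbhs_right_gt.
by rewrite powR_mulrn ?(ltW rho0)// normrX gtr0_norm.
Unshelve. all: by end_near. Qed.

(** An O(rho^r) is compared with a quantity bounded below by a multiple of
    rho^mu; such quotients by [I_k + eps] are what the weights are made of. *)
Lemma Opow_le_lower f (y : R -> R) r (mu : R) c : 0 < c ->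
  (\forall rho \near 0^'+, c * rho `^ mu <= y rho) -> Opow f r ->
  exists C, \forall rho \near 0^'+, `|f rho| <= C * rho `^ (r - mu) * y rho.
Proof.
move=> c0 cy /OpowP[C C0 fC]; exists (C / c); near=> rho.
have rho0 : 0 < rho by near: rho; exact: nbhs_right_gt.
apply: le_trans (near fC rho _) _ => //.
have -> : rho `^ r = rho `^ (r - mu) * rho `^ mu.
  by rewrite -powRD ?subrK// (gt_eqF rho0) implybT.
rewrite -!mulrA ler_pM2l// mulrCA ler_wpM2l ?powR_ge0//.
rewrite -(ler_pM2l c0) mulrA mulfV ?gt_eqF// mul1r.
exact: (near cy).
Unshelve. all: by end_near. Qed.

End OrderCalculus.

(** * Forms in the data on a finite stencil *)

Section LocalForms.
Variables (R : realType) (T : choiceType) (S : {fset T}).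
Implicit Types (v : T -> R) (phi : (T -> R) -> R).

(** A functional of the cell averages that only looks at the cells of a finite
    stencil has finitely many coefficients ([local_linearE]); this is what makes
    its bounds uniform in the mesh size. *)
Definition local_linear phi : Prop :=
  (forall c v v', phi (fun i => c * v i + v' i) = c * phi v + phi v') /\
  (forall v v', {in S, v =1 v'} -> phi v = phi v').

Lemma local_linearE phi v : local_linear phi ->
  phi v = \sum_(i <- S) v i * phi (fun j => (j == i)%:R).
Proof.
move=> [lin loc].
have lin0 : phi (fun=> 0) = 0.
  have := lin 1 (fun=> 0) (fun=> 0).
  rewrite (_ : (fun _ => _) = fun=> 0); last by apply/funext => i; rewrite mulr0 addr0.
  by rewrite mul1r; lra.
transitivity (phi (fun j => \sum_(i <- S) v i * (j == i)%:R)).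
  apply: loc => j jS; rewrite (bigD1_seq j) ?fset_uniq//= eqxx mulr1.
  by rewrite big1 ?addr0// => i ij; rewrite eq_sym (negbTE ij) mulr0.
elim: (S : seq T) => [|i s ih].
  by rewrite big_nil -lin0; congr phi; apply/funext => j; rewrite big_nil.
rewrite big_cons -ih -lin; congr phi; apply/funext => j.
by rewrite big_cons.
Qed.

Lemma Opow_local_linear phi (e : R -> T -> R) r : local_linear phi ->
  (forall i, i \in S -> Opow (e^~ i) r) -> Opow (fun rho => phi (e rho)) r.
Proof.
move=> lphi er; under eq_fun do rewrite (local_linearE _ lphi).
apply: Opow_sum => i iS _; rewrite -[r]addr0.
by apply: OpowM; [exact: er|exact: Opow_cst].
Qed.

Definition local_bilinear (B : (T -> R) -> (T -> R) -> R) : Prop :=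
  (forall v, local_linear (B v)) /\ (forall v', local_linear (B^~ v')).

Lemma Opow_local_bilinear B (e f : R -> T -> R) r r' : local_bilinear B ->
  (forall i, i \in S -> Opow (e^~ i) r) -> (forall i, i \in S -> Opow (f^~ i) r') ->
  Opow (fun rho => B (e rho) (f rho)) (r + r').
Proof.
move=> [B2 B1] er fr; under eq_fun do rewrite (local_linearE _ (B1 _)).
apply: Opow_sum => i iS _; apply: OpowM; first exact: er.
exact: Opow_local_linear.
Qed.

End LocalForms.

(** * The Jiang-Shu quadratic form *)

Section JiangShuForm.
Variables (R : realType) (n : nat) (dx : 'rV[R]_n).
Hypothesis dx0 : forall j, 0 < dx 0 j.
Implicit Types (p q : mpoly n R) (d : nat).

(** The bilinear form whose diagonal is the Jiang-Shu indicator. *)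
Definition js_form d p q : R :=
  \sum_(b : bmultinom n d.+1 | (1 <= mdeg b)%N)
    mpow dx (fun j => (2 * b j)%N%:Z - 1) * \prod_j dx 0 j *
    poly_avg dx 0 (mderivm b p * mderivm b q).

Lemma js_formC d p q : js_form d p q = js_form d q p.
Proof. by apply: eq_bigr => b _; rewrite mulrC [in RHS]mulrC (mulrC (mderivm b p)). Qed.

Lemma js_form_linear d p : linear_for *%R (js_form d p).
Proof.
move=> c q q'; rewrite mulr_sumr -big_split /=; apply: eq_bigr => b _.
by rewrite linearP /= mulrDr -scalerAr linearP /=; ring.
Qed.

Lemma js_weight_gt0 (b : multinom n) :
  0 < mpow dx (fun j => (2 * b j)%N%:Z - 1) * \prod_j dx 0 j.
Proof. by rewrite mulr_gt0 ?prodr_gt0// => j _; rewrite exprz_gt0. Qed.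

Lemma js_form_ge0 d q : 0 <= js_form d q q.
Proof.
apply: sumr_ge0 => b _; rewrite mulr_ge0 ?(ltW (js_weight_gt0 _))//.
by rewrite -expr2 poly_avg_sqr_ge0.
Qed.

(** Keep a single derivative [a] and bound the mean of its square below by the
    square of its mean. *)
Lemma js_form_ge d q (a : multinom n) : (1 <= mdeg a <= d)%N ->
  mpow dx (fun j => (2 * a j)%N%:Z - 1) * \prod_j dx 0 j *
    poly_avg dx 0 (mderivm a q) ^+ 2 <= js_form d q q.
Proof.
move=> /andP[a1 ad]; rewrite /js_form (bigD1 (BMultinom (ad : (mdeg a < d.+1)%N))) //=.
rewrite -[leLHS]addr0 lerD//.
  by rewrite ler_pM2l ?js_weight_gt0// -expr2 poly_avg_variance.
apply: sumr_ge0 => b _; rewrite mulr_ge0 ?(ltW (js_weight_gt0 _))//.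
by rewrite -expr2 poly_avg_sqr_ge0.
Qed.

Lemma js_form_const d q (c : R) : js_form d (mpolyC n c) q = 0.
Proof.
apply: big1 => b b1; rewrite (_ : mderivm b _ = 0) ?mul0r ?linear0 ?mulr0//.
apply/mpolyP => m; rewrite mcoeff_mderivm mcoeffC mcoeff0.
rewrite mnmD_eq0 -(mdeg_eq0 b); case: eqP => b0; last by rewrite mulr0 mul0rn.
by rewrite b0 in b1.
Qed.

(** Derivatives of order above the degree vanish, so the range of summation of
    the indicator does not matter; this makes indicators of [P_opt] and of the
    low-degree polynomials comparable. *)
Lemma js_form_degree d d' p q : (d <= d')%N -> (msize p <= d.+1)%N ->
  js_form d' p q = js_form d p q.
Proof.
move=> dd' /msize_leP sp; rewrite /js_form.
rewrite (bigID (fun b : bmultinom n d'.+1 => mdeg b < d.+1)%N) /=.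
rewrite [X in _ + X]big1 ?addr0; last first.
  move=> b /andP[_]; rewrite -leqNgt => db.
  rewrite (_ : mderivm b _ = 0) ?mul0r ?linear0 ?mulr0//.
  apply/mpolyP => m; rewrite mcoeff_mderivm sp ?mul0rn ?mcoeff0//.
  by rewrite mdegD (leq_trans db)// leq_addr.
pose emb (b : bmultinom n d.+1) : bmultinom n d'.+1 :=
  BMultinom (leq_trans (bmdeg b) (dd' : d.+1 <= d'.+1)%N : (mdeg b < d'.+1)%N).
pose res (b : bmultinom n d'.+1) : bmultinom n d.+1 := insubd bm0 (b : multinom n).
rewrite (reindex_onto emb res) /=; last first.
  by move=> b /andP[_ bd]; apply/val_inj; rewrite /= /res insubdK.
apply: eq_big => // b; rewrite bmdeg andbT /res.
by rewrite (_ : insubd _ _ = b) ?eqxx ?andbT//; apply/val_inj; rewrite insubdK// -topredE /= bmdeg.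
Qed.

Lemma mderivm_dilate (c : R) (b : multinom n) q :
  mderivm b (dilate c q) = c ^+ mdeg b *: dilate c (mderivm b q).
Proof.
apply/mpolyP => m; rewrite !(mcoeffZ, mcoeff_mderivm, mcoeff_dilate).
by rewrite mdegD exprD -!mulrnAr mulrA.
Qed.

(** The weights [dx^(2b - 1)] of the indicator make it invariant under a change
    of mesh size. *)
Lemma jiang_shu_dilate d q (c : R) : 0 < c ->
  jiang_shu d (c *: dx) q = js_form d (dilate c q) (dilate c q).
Proof.
move=> c0; rewrite /jiang_shu; apply: eq_bigr => b _.
have cdx0 j : 0 < (c *: dx) 0 j by rewrite mxE mulr_gt0.
have E (k : R) p : poly_avg dx 0 (k *: p * (k *: p)) = k * k * poly_avg dx 0 (p * p).
  by rewrite -scalerAl -scalerAr scalerA linearZ.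
rewrite cell_integralE// !mderivm_dilate E.
have -> : cell_avg (c *: dx) 0 (fun x => peval (mderivm b q) x ^+ 2) =
    poly_avg (c *: dx) 0 (mderivm b q * mderivm b q).
  rewrite -cell_avg_peval//; congr cell_avg; apply/funext => x.
  by rewrite /peval rmorphM expr2.
rewrite poly_avg_dilate ?gt_eqF// poly_avg_dilateM// !mulrA; congr (_ * _).
have -> : mpow (c *: dx) (fun j => (2 * b j)%N%:Z - 1) =
   mpow dx (fun j => (2 * b j)%N%:Z - 1) * \prod_(j < n) c ^ ((2 * b j)%N%:Z - 1).
  by rewrite -big_split; apply: eq_bigr => j _; rewrite mxE expfzMl mulrC.
rewrite -!mulrA; congr (_ * _).
rewrite -exprD addnn -mul2n mdegE big_distrr -prodrXr -!big_split /=.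
apply: eq_bigr => j _; rewrite mxE mulrA mulrC; congr (_ * _).
by rewrite -{2}(expr1z c) -expfzDr ?gt_eqF// subrK.
Qed.

End JiangShuForm.

(** * Polynomials as smooth data *)

Section SmoothPolynomials.
Variables (R : realType) (n : nat).
Implicit Types (q : mpoly n R) (x : 'rV[R]_n).

Lemma mpoly_ring_ind (P : mpoly n R -> Prop) :
  (forall c, P (mpolyC n c)) -> (forall j, P (mpolyX R (mnm1 j))) ->
  (forall p q, P p -> P q -> P (p + q)) -> (forall p q, P p -> P q -> P (p * q)) ->
  forall q, P q.
Proof.
move=> PC PX PD PM; elim/mpolyind => [|c m p _ _ Pp].
  by rewrite -(mpolyC0 n R).
apply: (PD) => //; rewrite -mul_mpolyC; apply: (PM) => //; rewrite mpolyXE_id.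
apply: big_ind => [|p' q'|j _]; first by rewrite -(mpolyC1 n R).
  exact: PM.
by elim: (m j) => [|k ih]; [rewrite expr0 -(mpolyC1 n R)|rewrite exprS; exact: PM].
Qed.

Lemma pevalC c x : peval (mpolyC n c) x = c. Proof. exact: mevalC. Qed.

Lemma pevalXU j x : peval (mpolyX R (mnm1 j)) x = x 0 j. Proof. exact: mevalXU. Qed.

Lemma pevalD p q x : peval (p + q) x = peval p x + peval q x.
Proof. exact: mevalD. Qed.

Lemma pevalM p q x : peval (p * q) x = peval p x * peval q x.
Proof. exact: mevalM. Qed.

Lemma peval_lincomb (I : finType) (c : I -> R) (q : I -> mpoly n R) x :
  peval (\sum_i c i *: q i) x = \sum_i c i * peval (q i) x.
Proof.
rewrite /peval (raddf_sum (meval _)) /=; apply: eq_bigr => i _; exact: mevalZ.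
Qed.

Lemma continuous_peval q : continuous (peval q).
Proof.
elim/mpoly_ring_ind: q => [c|j|p q pc qc|p q pc qc] x.
- rewrite (_ : peval _ = cst c); first exact: cst_continuous.
  by apply/funext => y; rewrite pevalC.
- rewrite (_ : peval _ = fun y : 'rV[R]_n => y 0 j); first exact: coord_continuous.
  by apply/funext => y; rewrite pevalXU.
- rewrite (_ : peval _ = peval p \+ peval q); last by apply/funext => y; rewrite pevalD.
  exact: (@continuousD _ _ _ (peval p) (peval q) x (pc x) (qc x)).
- rewrite (_ : peval _ = peval p \* peval q); last by apply/funext => y; rewrite pevalM.
  exact: (@continuousM _ _ (peval p) (peval q) x (pc x) (qc x)).
Qed.

Lemma is_derive_peval q x i :
  is_derive x (delta_mx 0 i) (peval q) (peval (mderiv i q) x).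
Proof.
elim/mpoly_ring_ind: q => [c|j|p q pd qd|p q pd qd].
- rewrite mderivC (_ : peval (mpolyC n c) = cst c); last first.
    by apply/funext => y; rewrite pevalC.
  by rewrite -(mpolyC0 n R) pevalC; exact: is_derive_cst.
- rewrite mderivX (_ : peval (mpolyX R (mnm1 j)) = fun y : 'rV[R]_n => y 0 j); last first.
    by apply/funext => y; rewrite pevalXU.
  have -> : peval ((mnm1 j i)%:R *: mpolyX R (mnm_sub (mnm1 j) (mnm1 i))) x =
      (delta_mx 0 i : 'rV[R]_n) 0 j.
    rewrite mnm1E mxE eqxx eq_sym; case: eqP => [->|_].
      rewrite scale1r (_ : mnm_sub _ _ = mnm0); last first.
        by apply/mnmP => k; rewrite mnmBE mnm0E subnn.
      by rewrite mpolyX0 -(mpolyC1 n R) pevalC.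
    by rewrite scale0r -(mpolyC0 n R) pevalC.
  apply: DeriveDef; first exact/diff_derivable/differentiable_coord.
  rewrite deriveE; last exact: differentiable_coord.
  pose f : 'rV[R]_n -> R := fun y => y 0 j.
  have lf : linear f by move=> k y z; rewrite /f !mxE.
  pose lfM := GRing.isLinear.Build _ _ _ _ f lf.
  pose fL : {linear _ -> _} := HB.pack f lfM.
  have -> : (fun y : 'rV[R]_n => y 0 j) = fL by [].
  by rewrite diff_lin//; exact: coord_continuous.
- rewrite mderivD pevalD (_ : peval (p + q) = peval p + peval q).
    exact: is_deriveD.
  by apply/funext => y; rewrite pevalD.
- rewrite mderivM (_ : peval (p * q) = peval p * peval q); last first.
    by apply/funext => y; rewrite pevalM.
  apply: is_derive_eq; rewrite pevalD !pevalM /GRing.scale /= addrC.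
  by congr (_ + _); rewrite mulrC.
Unshelve. all: by end_near. Qed.

Lemma pderivs_peval (s : seq 'I_n) q :
  pderivs s (peval q) = peval (foldr (@mderiv n R) q s).
Proof.
elim: s => //= i s; rewrite /pderivs => /= ->; apply/funext => x.
by case: (is_derive_peval (foldr (@mderiv n R) q s) x i).
Qed.

Lemma smooth_peval q : smooth_near0 (peval q).
Proof.
rewrite /smooth_near0; near=> x => s; rewrite pderivs_peval; split.
  by move=> i; case: (is_derive_peval (foldr (@mderiv n R) q s) x i).
exact: continuous_peval.
Unshelve. all: by end_near. Qed.

Lemma peval0 q : peval q 0 = mcoeff mnm0 q.
Proof.
elim/mpoly_ring_ind: q => [c|j|p q pE qE|p q pE qE].
- by rewrite pevalC mcoeffC eqxx mulr1.
- by rewrite pevalXU mxE mcoeffX mnm1_eq0.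
- by rewrite pevalD mcoeffD pE qE.
- by rewrite pevalM pE qE -rmorphM.
Qed.

(** Polynomials with a linear term are thus admissible data with a
    nonvanishing gradient at the origin. *)
Lemma critical_order_peval q i : mcoeff (mnm1 i) q != 0 ->
  critical_order (peval q) 0.
Proof.
move=> qi; split; first by move=> a /andP[a1 /(leq_trans a1)].
exists (mnm1 i); first exact: mdeg1.
rewrite /pderivm pderivs_peval -mderivm_foldr mderivmU1m peval0 mcoeff_mderiv.
by rewrite add0m mnm0E.
Qed.

End SmoothPolynomials.

(** * Taylor polynomials *)

Section Taylor.
Variables (R : realType) (n : nat).
Implicit Types (f : 'rV[R]_n -> R) (x y : 'rV[R]_n) (d K t : R) (N : nat).

Lemma rV_norm_le x K : 0 <= K -> (forall j, `|x 0 j| <= K) -> `|x| <= K.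
Proof.
move=> K0 xK; rewrite /Num.norm /= mx_normrE; apply: bigmax_le => //= -[i j] _ /=.
by rewrite ord1.
Qed.

Lemma coord_norm_le x j : `|x 0 j| <= `|x|.
Proof.
rewrite [leRHS]/Num.norm /= mx_normrE.
exact: (le_bigmax _ (fun ij => `|x ij.1 ij.2|) (0, j)).
Qed.

Definition smooth_on_ball d f : Prop := forall x, `|x| < d ->
  forall s : seq 'I_n, (forall i, derivable (pderivs s f) x (delta_mx 0 i)) /\
    {for x, continuous (pderivs s f)}.

Lemma smooth_on_ball_pderiv d f i : smooth_on_ball d f ->
  smooth_on_ball d (pderiv i f).
Proof.
move=> fs x xd s; have := fs x xd (rcons s i).
by rewrite /pderivs foldr_rcons.
Qed.

Lemma smooth_on_ball_iter d f i k : smooth_on_ball d f ->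
  smooth_on_ball d (iter k (pderiv i) f).
Proof. by move=> fs; elim: k => //= k; exact: smooth_on_ball_pderiv. Qed.

Lemma is_derive_line d f j y t : smooth_on_ball d f ->
  `|y + t *: delta_mx 0 j| < d ->
  is_derive t (1 : R) (fun s => f (y + s *: delta_mx 0 j))
    (pderiv j f (y + t *: delta_mx 0 j)).
Proof.
move=> fs yd; have [fd _] := fs _ yd [::].
have E : (fun h : R => h^-1 *: (((fun s => f (y + s *: delta_mx 0 j)) \o shift t) (h *: (1 : R))
     - f (y + t *: delta_mx 0 j))) =
   (fun h : R => h^-1 *: ((f \o shift (y + t *: delta_mx 0 j)) (h *: delta_mx 0 j) -
       f (y + t *: delta_mx 0 j))).
  apply/funext => h /=; congr (_ *: (f _ - _)).
  by rewrite -[h *: 1]/(h * 1) mulr1 scalerDl addrCA.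
by apply: DeriveDef; rewrite /derivable /pderiv /derive E //; exact: fd.
Qed.

(** One-dimensional Taylor estimate along a coordinate direction, by induction
    on the order and the mean value theorem: the derivative of the remainder is
    the remainder of the derivative. *)
Lemma taylor_line d f j N K : smooth_on_ball d f ->
  (forall x, `|x| < d -> `|iter N (pderiv j) f x| <= K) ->
  forall y t, (forall s, `|s| <= `|t| -> `|y + s *: delta_mx 0 j| < d) ->
  `|f (y + t *: delta_mx 0 j) -
    \sum_(k < N) t ^+ k / k`!%:R * iter k (pderiv j) f y| <= K * `|t| ^+ N.
Proof.
elim: N f => [|N ih] f fs fK y t yd.
  by rewrite big_ord0 subr0 expr0 mulr1; apply: fK; exact: yd.
pose a k := iter k (pderiv j) f y.
pose p : {poly R} := \poly_(k < N.+1) (a k / k`!%:R).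
have pE s : p.[s] = \sum_(k < N.+1) s ^+ k / k`!%:R * a k.
  rewrite horner_poly; apply: eq_bigr => k _.
  by rewrite mulrC mulrA mulrAC.
have p'E s : p^`().[s] = \sum_(k < N) s ^+ k / k`!%:R * iter k (pderiv j) (pderiv j f) y.
  rewrite (_ : p^`() = \poly_(k < N) (a k.+1 / k`!%:R)); last first.
    apply/polyP => k; rewrite coef_deriv !coef_poly ltnS; case: ltnP => _; last by rewrite mul0rn.
    rewrite -(mulr_natr (a k.+1 / _)) factS natrM invfM -mulrA mulrAC mulVf ?mul1r// pnatr_eq0.
  rewrite horner_poly; apply: eq_bigr => k _; by rewrite /a iterSr mulrC mulrA mulrAC.
pose h s := f (y + s *: delta_mx 0 j) - p.[s].
have h0 : h 0 = 0.
  rewrite /h pE scale0r addr0 big_ord_recl expr0 fact0 divr1 mul1r /a /=.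
  by rewrite big1 ?addr0 ?subrr// => k _; rewrite exprS !mul0r.
have hd s : `|s| <= `|t| -> is_derive s (1 : R) h
    (pderiv j f (y + s *: delta_mx 0 j) - p^`().[s]).
  move=> st; have fd := is_derive_line fs (yd s st).
  exact: (@is_deriveB _ _ _ _ (horner p) s 1 _ _ fd (is_derive_poly p s)).
have hb s : `|s| <= `|t| ->
    `|pderiv j f (y + s *: delta_mx 0 j) - p^`().[s]| <= K * `|t| ^+ N.
  move=> st; rewrite p'E; apply: le_trans (ih (pderiv j f) _ _ y s _) _.
  - exact: smooth_on_ball_pderiv.
  - by move=> x xd; rewrite -iterSr; exact: fK.
  - by move=> r rs; apply: yd; exact: le_trans st.
  - rewrite ler_wpM2l ?lerXn2r ?nnegrE//.
    by apply: le_trans (fK y _) => //; rewrite -[y]addr0 -(scale0r (delta_mx 0 j)) yd// normr0.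
rewrite -pE -/(h t) exprSr mulrA.
have cont (b c : R) : (forall s, s \in `[b, c] -> `|s| <= `|t|) ->
    {within `[b, c], continuous h}.
  move=> bc; apply: derivable_within_continuous => s /bc st.
  by case: (hd s st).
have [t0|t0] := leP 0 t.
  have bt s : s \in `[0, t] -> `|s| <= `|t|.
    by rewrite in_itv/= => /andP[s0 st]; rewrite !ger0_norm// (le_trans s0).
  have [c ct] := @MVT_segment R h _ 0 t t0
    (fun s st => hd s (bt s (subset_itv_oo_cc st))) (cont _ _ bt).
  by rewrite h0 !subr0 => ->; rewrite normrM ler_wpM2r// hb// bt.
have bt s : s \in `[t, 0] -> `|s| <= `|t|.
  by rewrite in_itv/= => /andP[st s0]; rewrite !ler0_norm ?lerN2// ltW.
have [c ct] := @MVT_segment R h _ t 0 (ltW t0)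
  (fun s st => hd s (bt s (subset_itv_oo_cc st))) (cont _ _ bt).
rewrite h0 !sub0r => /eqP; rewrite eqr_oppLR => /eqP ->.
by rewrite !normrN normrM normrN ler_wpM2r// hb// bt.
Qed.

Definition smooth_ball f : Prop := exists2 d, 0 < d & smooth_on_ball d f.

Lemma smooth_near0_ball f : smooth_near0 f -> smooth_ball f.
Proof. by move=> /nbhs_norm0P[d /= d0 fd]; exists d => // x xd; exact: fd. Qed.

Definition coord_proj (js : seq 'I_n) x : 'rV[R]_n :=
  \row_k (if k \in js then x 0 k else 0).

(** Taylor expansion, one coordinate at a time: expanding in the coordinate [j]
    leaves, as coefficients, functions of the remaining coordinates to which the
    induction hypothesis applies. *)
Lemma taylor_coord (js : seq 'I_n) f N : uniq js -> smooth_ball f ->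
  exists w C, (msize w <= N)%N /\
    \forall x \near (0 : 'rV[R]_n), `|f (coord_proj js x) - peval w x| <= C * `|x| ^+ N.
Proof.
elim: js f N => [|j js ih] f N.
  move=> _ _; have proj0 x : coord_proj [::] x = 0 by apply/rowP => k; rewrite !mxE.
  case: N => [|N].
    exists 0, `|f 0|; split; first by rewrite msize0.
    by near=> x; rewrite proj0 -(mpolyC0 n R) pevalC subr0 expr0 mulr1.
  exists (mpolyC n (f 0)), 0; split; first by rewrite msizeC; case: (_ != 0).
  by near=> x; rewrite proj0 pevalC subrr normr0 mul0r.
move=> /andP[jjs ujs] [d d0 fs].
have /choice[w /choice[C wP]] : forall k : 'I_N, exists w C, (msize w <= N - k)%N /\
    \forall x \near (0 : 'rV[R]_n), `|iter k (pderiv j) f (coord_proj js x) - peval w x|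
       <= C * `|x| ^+ (N - k).
  move=> k; apply: ih => //; exists d => //; exact: smooth_on_ball_iter.
pose K := `|iter N (pderiv j) f 0| + 1.
have [e e0 eK] : exists2 e, 0 < e & forall x, `|x| < e ->
    `|iter N (pderiv j) f x| <= K.
  have fc : {for 0, continuous (iter N (pderiv j) f)}.
    have := smooth_on_ball_iter j N fs; move=> /(_ 0); rewrite normr0 => /(_ d0 [::]) [_].
    exact.
  have /nbhs_norm0P[e /= e0 eK] : \forall x \near (0 : 'rV[R]_n), `|iter N (pderiv j) f x| <= K.
    by apply: cvgr_norm_le fc _ _; rewrite ltrDl.
  by exists e.
exists (\sum_(k < N) ((k`!%:R)^-1 *: w k) * mpolyX R (mnm_muln (mnm1 j) k)).
exists (\sum_(k < N) `|(k`!%:R)^-1| * C k + K); split.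
  apply/msize_leP => m Nm; rewrite raddf_sum /= big1// => k _.
  apply/eqP; rewrite mcoeff_eq0 (perm_mem (msuppMX _ _)); apply/negP => /mapP[m' m'w mE].
  have : (mdeg m' < N - k)%N.
    apply: leq_trans (wP k).1; apply: msize_mdeg_lt.
    by apply: contraTT m'w => /memN_msupp_eq0 m'0; rewrite -mcoeff_eq0 mcoeffZ m'0 mulr0.
  move: Nm; rewrite mE mdegD mdegMn mdeg1 mul1n ltn_subRL addnC; lia.
pose de := Num.min d e.
have de0 : 0 < de by rewrite lt_min d0 e0.
have fsde : smooth_on_ball de f.
  by move=> x; rewrite lt_min => /andP[xd _]; exact: fs.
have eKde x : `|x| < de -> `|iter N (pderiv j) f x| <= K.
  by rewrite lt_min => /andP[_]; exact: eK.
have nde : \forall x \near (0 : 'rV[R]_n), `|x| < de.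
  by apply/nbhs_norm0P; exists de.
near=> x.
have xde : `|x| < de by near: x; exact: nde.
have xk (k : 'I_N) : `|iter k (pderiv j) f (coord_proj js x) - peval (w k) x|
       <= C k * `|x| ^+ (N - k).
  move: k; near: x; apply: filter_forall => k; exact: (wP k).2.
have projE : coord_proj (j :: js) x = coord_proj js x + x 0 j *: delta_mx 0 j.
  apply/rowP => k; rewrite !mxE inE /=; case: eqP => [->|_] /=.
    by rewrite (negbTE jjs) add0r mulr1.
  by rewrite mulr0 addr0.
rewrite projE.
have line := taylor_line fsde eKde (y := coord_proj js x) (t := x 0 j).
apply: le_trans (_ : `|f (coord_proj js x + x 0 j *: delta_mx 0 j) -
    \sum_(k < N) x 0 j ^+ k / k`!%:R * iter k (pderiv j) f (coord_proj js x)| +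
   \sum_(k < N) `|x 0 j ^+ k / k`!%:R *
      (iter k (pderiv j) f (coord_proj js x) - peval (w k) x)| <= _).
  rewrite -[X in `|X|](subrKA (\sum_(k < N) x 0 j ^+ k / k`!%:R *
    iter k (pderiv j) f (coord_proj js x))).
  apply: le_trans (ler_normD _ _) _; rewrite lerD2l.
  apply: le_trans (ler_norm_sum _ _ _); rewrite le_eqVlt; apply/orP; left.
  apply/eqP; congr `|_|; rewrite [peval (\sum_(k < N) _) x](raddf_sum (meval _)) /=.
  rewrite -sumrB; apply: eq_bigr => k _; rewrite mulrBr; congr (_ - _).
  rewrite mevalM mevalZ mevalX -/(peval _ _).
  rewrite (bigD1 j)//= big1 ?mulr1; last first.
    by move=> l lj; rewrite mulmnE mnm1E eq_sym (negbTE lj) mul0n expr0.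
  by rewrite mulmnE mnm1E eqxx mul1n mulrC mulrA.
rewrite addrC mulrDl lerD//; last first.
  apply: le_trans (line _) _.
    move=> s sx; apply: le_lt_trans xde; apply: rV_norm_le => // k.
    rewrite !mxE; case: (eqVneq k j) => [->|kj].
      by rewrite (negbTE jjs) add0r mulr1 (le_trans sx)// coord_norm_le.
    by rewrite mulr0 addr0; case: ifP => _; rewrite ?normr0// coord_norm_le.
  by rewrite ler_wpM2l ?addr_ge0// lerXn2r ?nnegrE// coord_norm_le.
rewrite mulr_suml; apply: ler_sum => k _.
rewrite normrM normrM normrX [_ ^+ k * _]mulrC -!mulrA ler_wpM2l//.
have -> : C k * `|x| ^+ N = `|x| ^+ k * (C k * `|x| ^+ (N - k)).
  by rewrite mulrCA -exprD subnKC// ltnW.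
by rewrite ler_pM ?exprn_ge0// lerXn2r ?nnegrE// coord_norm_le.
Unshelve. all: by end_near. Qed.

Lemma taylor_polynomial f N : smooth_near0 f ->
  exists w C, (msize w <= N)%N /\
    \forall x \near (0 : 'rV[R]_n), `|f x - peval w x| <= C * `|x| ^+ N.
Proof.
move=> /smooth_near0_ball/(taylor_coord N (enum_uniq 'I_n))[w [C [sw wC]]].
exists w, C; split=> //; near=> x.
have {1}-> : x = coord_proj (enum 'I_n) x.
  by apply/rowP => k; rewrite mxE mem_enum.
by near: x.
Unshelve. all: by end_near. Qed.

End Taylor.

(** * Orders of polynomials in the mesh size *)

Section PolynomialOrder.
Variable R : realType.
Implicit Types (P : {poly R}) (f : R -> R).

(** Factor out the largest power of the variable; the cofactor is continuous and
    nonzero at 0. *)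
Lemma has_order_poly P f : P != 0 ->
  (\forall rho \near 0^'+, f rho = `|P.[rho]|) ->
  exists j : nat, has_order f (j%:R)%:E /\ Opow (horner P) j%:R.
Proof.
move=> P0 fP; have [j [Q Q0 PE]] := multiplicity_XsubC P 0.
move: Q0; rewrite P0 /= /root => Q0.
have PjE rho : P.[rho] = Q.[rho] * rho ^+ j.
  by rewrite PE hornerM horner_exp hornerXsubC subr0.
have Qc e : 0 < e -> \forall rho \near (0 : R)^'+, `|Q.[rho] - Q.[0]| <= e.
  move=> e0; have Q0c : Q.[x] @[x --> (0 : R)^'+] --> Q.[0].
    by apply: cvg_at_right_filter; exact: continuous_horner.
  exact: (cvgr_distC_le _ _ Q0c e e0).
exists j; split.
- exists `|Q.[0]|; first by rewrite normr_eq0.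
  apply/eqoP => e e0; near=> rho.
  have rho0 : 0 < rho by near: rho; exact: nbhs_right_gt.
  rewrite (near fP rho)// PjE !powR_mulrn ?(ltW rho0)//.
  have rj : 0 < rho ^+ j by rewrite exprn_gt0.
  rewrite normrM !(gtr0_norm rj) -mulrBl normrM (gtr0_norm rj) ler_pM2r//.
  by apply: le_trans (ler_dist_dist _ _) _; near: rho; exact: Qc.
- rewrite -[j%:R]add0r.
  apply: Opow_near (_ : Opow (fun rho => Q.[rho] * rho ^+ j) _).
    by near=> rho; rewrite PjE.
  apply: OpowM; last exact: Opow_exp.
  exists (`|Q.[0]| + 1); near=> rho; rewrite powRr0 mulr1.
  rewrite -[Q.[rho]](subrK Q.[0]) (le_trans (ler_normD _ _))// addrC lerD2l.
  by near: rho; exact: Qc.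
Unshelve. all: by end_near. Qed.

End PolynomialOrder.

(** * The nonlinear weights *)

Section NonlinearWeights.
Variable R : realType.

(** For an integer [L] above [ell], [z `^ ell] lies between [1] and [z ^+ L], and
    the integer power is Lipschitz by the geometric sum. *)
Lemma powR_lipschitz1 (ell : R) : 0 <= ell ->
  exists2 K, 0 <= K & forall z : R, 0 < z <= 2 -> `|z `^ ell - 1| <= K * `|z - 1|.
Proof.
move=> ell0; have [L ellL] : exists L : nat, ell <= L%:R.
  by exists (Num.bound ell); exact/ltW/archi_boundP.
exists (\sum_(i < L) 2 ^+ i); first by apply: sumr_ge0 => i _; rewrite exprn_ge0.
move=> z /andP[z0 z2].
apply: (@le_trans _ _ `|z ^+ L - 1|).
  have [z1|z1] := leP 1 z.
    have e1 : 1 <= z `^ ell by rewrite -(powRr0 z) ler_powR.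
    have e2 : z `^ ell <= z ^+ L by rewrite -powR_mulrn ?(ltW z0)// ler_powR.
    by rewrite !ger0_norm ?subr_ge0 ?lerB// (le_trans e1).
  have z01 : 0 < z <= 1 by rewrite z0 ltW.
  have e1 : z `^ ell <= 1 by rewrite -(powRr0 z) ger_powR.
  have e2 : z ^+ L <= z `^ ell by rewrite -powR_mulrn ?(ltW z0)// ger_powR.
  by rewrite !ler0_norm ?subr_le0 ?lerN2 ?lerB// (le_trans e2).
rewrite subrX1 normrM mulrC ler_wpM2r// (le_trans (ler_norm_sum _ _ _))//.
apply: ler_sum => i _; rewrite ger0_norm ?exprn_ge0 ?(ltW z0)//.
by rewrite lerXn2r ?nnegrE// ltW.
Qed.

Variables (m : nat) (d : 'I_m.+1 -> R) (y : 'I_m.+1 -> R -> R) (tau : R -> R).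
Variables (ell e D : R).
Hypothesis d_gt0 : forall k, 0 < d k.
Hypothesis d_sum : \sum_k d k = 1.
Hypothesis ell_ge1 : 1 <= ell.
Hypothesis tau_ge0 : forall rho, 0 <= tau rho.
Hypothesis y_gt0 : forall k, \forall rho \near 0^'+, 0 < y k rho.
Hypothesis tau_le : forall k, exists C,
  \forall rho \near 0^'+, tau rho <= C * rho `^ e * y k rho.
Hypothesis y_close : forall k j, exists C,
  \forall rho \near 0^'+, `|y k rho - y j rho| <= C * rho * y j rho.
Hypothesis De : D <= ell * e.

Let X k rho := (tau rho / y k rho) `^ ell.

Lemma ratio_power_Opow k : Opow (X k) D.
Proof.
apply: OpowW De _.
have [C tauC] := tau_le k; exists (`|C| `^ ell); near=> rho.
have rho0 : 0 < rho by near: rho; exact: nbhs_right_gt.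
have yk0 : 0 < y k rho by near: rho; exact: y_gt0.
rewrite /X ger0_norm ?powR_ge0// (mulrC ell) powRrM -powRM ?powR_ge0//.
have ell0 : 0 <= ell by exact: le_trans ler01 _.
apply: ge0_ler_powR => //; rewrite ?nnegrE ?mulr_ge0 ?powR_ge0 ?invr_ge0 ?(ltW yk0)//.
rewrite ler_pdivrMr//; apply: le_trans (near tauC rho _) _ => //.
by rewrite ler_pM2r// ler_wpM2r ?powR_ge0// ler_norm.
Unshelve. all: by end_near. Qed.

(** Since [X k = X j * (y j / y k) `^ ell] and the quotient is [1 + O(rho)], the
    difference gains one power of [rho] over the size of [X j]. *)
Lemma ratio_power_close k j : Opow (fun rho => X k rho - X j rho) (D + 1).
Proof.
have ell0 : 0 <= ell by exact: le_trans ler01 _.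
have [K K0 lip] := powR_lipschitz1 ell0.
have [C yC] := y_close j k; pose C' := `|C| + 1.
have C'0 : 0 < C' by rewrite ltr_wpDl.
pose Z rho := (y j rho / y k rho) `^ ell - 1.
have ZO : Opow Z 1.
  exists (K * C'); near=> rho.
  have rho0 : 0 < rho by near: rho; exact: nbhs_right_gt.
  have yk0 : 0 < y k rho by near: rho; exact: y_gt0.
  have yj0 : 0 < y j rho by near: rho; exact: y_gt0.
  have rho1 : rho <= C'^-1 by near: rho; apply: nbhs_right_le; rewrite invr_gt0.
  have z1 : `|y j rho / y k rho - 1| <= C' * rho.
    rewrite -[X in _ - X](divff (lt0r_neq0 yk0)) -mulrBl normrM.
    rewrite (gtr0_norm (_ : 0 < (y k rho)^-1)) ?invr_gt0// ler_pdivrMr//.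
    apply: le_trans (near yC rho _) _ => //; rewrite !ler_pM2r//.
    by rewrite (le_trans (ler_norm C))// lerDl.
  have C'rho : C' * rho <= 1 by rewrite mulrC -ler_pdivlMr// div1r.
  have z2 : 0 < y j rho / y k rho <= 2.
    rewrite divr_gt0//=; move: (le_trans z1 C'rho); rewrite ler_norml; lra.
  rewrite powRr1 ?(ltW rho0)// -mulrA (le_trans (lip _ z2))//.
  by rewrite ler_wpM2l.
apply: Opow_near (OpowM (ratio_power_Opow j) ZO); near=> rho.
have yk0 : 0 < y k rho by near: rho; exact: y_gt0.
have yj0 : 0 < y j rho by near: rho; exact: y_gt0.
rewrite /Z mulrBr mulr1.
have -> : X k rho = X j rho * (y j rho / y k rho) `^ ell.
  rewrite -powRM ?divr_ge0 ?tau_ge0 ?(ltW yk0) ?(ltW yj0)//.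
  by rewrite mulrA divfK ?gt_eqF.
by [].
Unshelve. all: by end_near. Qed.

(** As the [d i] sum to 1, the deviation of the weight from [d k] is
    [d k * \sum_i d i * (X k - X i)] divided by a normalization that is at least
    1: only differences of the [X i] matter. *)
Lemma nonlinear_weight_close k :
  Opow (fun rho => d k * (1 + X k rho) / (\sum_i d i * (1 + X i rho)) - d k) (D + 1).
Proof.
apply: (@Opow_le _ _ (fun rho => d k * \sum_i d i * (X k rho - X i rho))); last first.
  by apply: OpowZ; apply: Opow_sum => i _ _; apply: OpowZ; exact: ratio_power_close.
near=> rho; set S := \sum_i _.
have SE : S = 1 + \sum_i d i * X i rho.
  by rewrite -d_sum -big_split; apply: eq_bigr => i _; rewrite mulrDr mulr1.
have S1 : 1 <= S.
  by rewrite SE lerDl sumr_ge0// => i _; rewrite mulr_ge0 ?powR_ge0// ltW.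
have S0 : 0 < S by rewrite (lt_le_trans ltr01).
have -> : d k * (1 + X k rho) / S - d k =
    d k * (\sum_i d i * (X k rho - X i rho)) / S.
  apply: (mulIf (lt0r_neq0 S0)); rewrite mulrBl !divfK ?gt_eqF//.
  under eq_bigr do rewrite mulrBr.
  by rewrite sumrB -mulr_suml d_sum SE; ring.
rewrite normrM ler_piMr// gtr0_norm ?invr_gt0// invf_le1//.
Unshelve. all: by end_near. Qed.

End NonlinearWeights.

(** * Candidates, indicators and tau as forms in the cell averages *)

Section Reconstruction.
Variables (R : realType) (n m : nat) (W : cwenoz R n m).
Implicit Types (u : 'rV[R]_n -> R) (rho : R) (k : 'I_m.+1) (w : mpoly n R).
Implicit Types (v : 'rV[int]_n -> R).
Local Notation s := (aspect W).
Local Notation s_gt0 := (aspect_gt0 W).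

Definition degree k : nat := if unlift ord0 k is Some _ then gdeg W else Gdeg W.

Definition stencil k : {fset 'rV[int]_n} :=
  if unlift ord0 k is Some j then Ssub W j else Sopt W.

(** The candidate polynomials in the coordinates scaled by the mesh size:
    there they depend linearly on the cell averages, with coefficients that do
    not involve the mesh size. *)
Definition candidate k v : mpoly n R := associated_poly (degree k) (stencil k) s v.

Lemma gdeg_le_degree k : (gdeg W <= degree k)%N.
Proof. by rewrite /degree; case: unlift => [_|]; rewrite ?leqnn ?(ltnW (gdeg_lt W)). Qed.

Lemma stencil0 k : 0 \in stencil k.
Proof. by rewrite /stencil; case: unlift => [j|]; [exact: Ssub0|exact: Sopt0]. Qed.

Lemma stencil_sub k : {subset stencil k <= Sopt W}.
Proof.
by rewrite /stencil; case: unlift => [j|] //; apply/fsubsetP; exact: Ssub_sub.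
Qed.

Lemma stencil_unique k rho : 0 < rho -> forall v,
  exists! q, is_associated (degree k) (stencil k) (rho *: s) v q.
Proof.
by rewrite /degree /stencil; case: unlift => [j|]; [exact: Ssub_unique|exact: Sopt_unique].
Qed.

Lemma mesh_gt0 rho : 0 < rho -> forall j, 0 < mesh W rho 0 j.
Proof. by move=> rho0 j; rewrite mxE mulr_gt0// aspect_gt0. Qed.

Lemma candidate_linear k c v v' :
  candidate k (fun i => c * v i + v' i) = c *: candidate k v + candidate k v'.
Proof. exact: (associated_poly_linear s_gt0 (stencil_unique k)). Qed.

Lemma candidate_local k v v' : {in Sopt W, v =1 v'} -> candidate k v = candidate k v'.
Proof.
move=> vv'; rewrite /candidate; apply: (associated_poly_local (stencil0 k) (stencil_unique k)).
by move=> i /stencil_sub; exact: vv'.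
Qed.

Lemma candidate_avg k w : (msize w <= (gdeg W).+1)%N ->
  candidate k (fun i => poly_avg s i w) = w.
Proof.
move=> sw; rewrite /candidate; apply: (associated_poly_avg s_gt0 (stencil_unique k)).
by rewrite (leq_trans sw)// ltnS gdeg_le_degree.
Qed.

Definition indicator_form k v v' : R :=
  js_form s (degree k) (candidate k v) (candidate k v').

Lemma IkE k u rho : 0 < rho ->
  Ik W k u rho = indicator_form k (averages W u rho) (averages W u rho).
Proof.
move=> rho0; rewrite /indicator_form /candidate.
rewrite -!(associated_poly_dilate s_gt0 (stencil_unique k) _ rho0).
rewrite -(jiang_shu_dilate s_gt0 _ _ rho0) /Ik /degree /stencil.
by case: unlift.
Qed.

Lemma indicator_form_bilinear k : local_bilinear (Sopt W) (indicator_form k).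
Proof.
split=> v; split.
- by move=> c v1 v2; rewrite /indicator_form candidate_linear js_form_linear.
- by move=> v1 v2 v12; rewrite /indicator_form (candidate_local k v12).
- move=> c v1 v2; rewrite /indicator_form candidate_linear.
  by rewrite !(js_formC _ _ _ (candidate k v)) js_form_linear.
- by move=> v1 v2 v12; rewrite /indicator_form (candidate_local k v12).
Qed.

(** tau is the absolute value of this form at the cell averages. *)
Definition tau_form v v' : R := \sum_k lcoef W k * indicator_form k v v'.

Lemma tauE u rho : 0 < rho ->
  tau W u rho = `|tau_form (averages W u rho) (averages W u rho)|.
Proof. by move=> rho0; rewrite /tau; under eq_bigr do rewrite IkE//. Qed.

Lemma tau_form_bilinear : local_bilinear (Sopt W) tau_form.
Proof.
split=> v; split=> [c v1 v2|v1 v2 v12]; rewrite /tau_form.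
- rewrite mulr_sumr -big_split; apply: eq_bigr => k _ /=.
  by rewrite (((indicator_form_bilinear k).1 v).1 c) mulrDr mulrCA.
- by apply: eq_bigr => k _; rewrite (((indicator_form_bilinear k).1 v).2 _ _ v12).
- rewrite mulr_sumr -big_split; apply: eq_bigr => k _ /=.
  by rewrite (((indicator_form_bilinear k).2 v).1 c) mulrDr mulrCA.
- by apply: eq_bigr => k _; rewrite (((indicator_form_bilinear k).2 v).2 _ _ v12).
Qed.

Definition avg_in_mesh w (i : 'rV[int]_n) : {poly R} :=
  \sum_(a <- msupp w) (mcoeff a w * poly_avg s i (mpolyX R a)) *: 'X^(mdeg a).

Definition poly_averages w rho : 'rV[int]_n -> R :=
  fun i => poly_avg s i (dilate rho w).

Lemma avg_in_meshE w rho i : (avg_in_mesh w i).[rho] = poly_averages w rho i.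
Proof.
rewrite /poly_averages /poly_avg extend_monomials_dilate horner_sum.
apply: eq_bigr => a _; rewrite hornerZ hornerXn /poly_avg extend_monomialsX.
by rewrite -mulrA (mulrC (_ * _)).
Qed.

Lemma averages_peval w rho : 0 < rho ->
  averages W (peval w) rho = poly_averages w rho.
Proof.
move=> rho0; apply/funext => i; rewrite /averages cell_avg_peval; last exact: mesh_gt0.
by rewrite poly_avg_dilate ?gt_eqF.
Qed.

Lemma poly_averages_linear c p w rho : poly_averages (c *: p + w) rho =
  (fun i => c * poly_averages p rho i + poly_averages w rho i).
Proof. by apply/funext => i; rewrite /poly_averages !linearP. Qed.

(** The monomial of degree [d] contributes a multiple of [rho ^+ d]. *)
Lemma poly_averages_Opow w (p : nat) i :
  (forall a, (mdeg a < p)%N -> mcoeff a w = 0) ->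
  Opow (fun rho => poly_averages w rho i) p%:R.
Proof.
move=> wp; under eq_fun do rewrite -avg_in_meshE horner_sum.
apply: Opow_sum => a aw _; under eq_fun do rewrite hornerZ hornerXn.
apply: OpowZ; apply: OpowW (Opow_exp _ _); rewrite ler_nat leqNgt.
by apply/negP => /wp /eqP; rewrite mcoeff_eq0 aw.
Qed.

Lemma cell_norm_le i : exists2 K, 0 <= K &
  forall rho x, 0 < rho -> cell (mesh W rho) i x -> `|x| <= K * rho.
Proof.
pose K := \sum_j (`|(i 0 j)%:~R| + 1) * s 0 j.
have Kj j : 0 <= (`|(i 0 j)%:~R| + 1) * s 0 j :> R.
  by rewrite mulr_ge0 ?addr_ge0// ltW// aspect_gt0.
exists K; first exact: sumr_ge0.
move=> rho x rho0 xi; apply: rV_norm_le => [|j].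
  by rewrite mulr_ge0 ?(ltW rho0)// sumr_ge0.
apply: (@le_trans _ _ ((`|(i 0 j)%:~R| + 1) * s 0 j * rho)); last first.
  by rewrite ler_pM2r// /K (bigD1 j)//= lerDl sumr_ge0.
have := xi j; rewrite !mxE -mulrA (mulrC (s 0 j)).
have sj : 0 < rho * s 0 j by rewrite mulr_gt0// aspect_gt0.
move: (rho * s 0 j) sj => t t0 /andP[lo hi].
have := ler_norm ((i 0 j)%:~R : R); have := ler_norm (- (i 0 j)%:~R : R).
rewrite normrN ler_norml; nra.
Qed.

(** The cell has size O(rho), hence so has the argument of the Taylor remainder
    on it. *)
Lemma averages_near u w C (N : nat) i :
  (\forall x \near (0 : 'rV[R]_n), `|u x - peval w x| <= C * `|x| ^+ N) ->
  Opow (fun rho => averages W u rho i - poly_averages w rho i) N%:R.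
Proof.
move=> /nbhs_norm0P[d /= d0 uw]; have [K K0 xK] := cell_norm_le i.
exists (`|C| * K ^+ N); near=> rho.
have rho0 : 0 < rho by near: rho; exact: nbhs_right_gt.
have rhod : K * rho < d.
  rewrite (@le_lt_trans _ _ ((K + 1) * rho))// ?ler_pM2r ?lerDl//.
  rewrite mulrC -ltr_pdivlMr ?ltr_wpDl//.
  by near: rho; apply: nbhs_right_lt; rewrite divr_gt0 ?ltr_wpDl.
rewrite powR_mulrn ?(ltW rho0)// -mulrA -exprMn.
rewrite /poly_averages -poly_avg_dilate ?gt_eqF//.
apply: cell_avg_near; first exact: mesh_gt0.
move=> x /(xK _ _ rho0) xr; apply: le_trans (uw x _) _.
  exact: le_lt_trans rhod.
rewrite (@le_trans _ _ (`|C| * `|x| ^+ N))// ?ler_wpM2r ?exprn_ge0 ?ler_norm//.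
by rewrite ler_wpM2l// lerXn2r ?nnegrE// (le_trans _ xr).
Unshelve. all: by end_near. Qed.

(** Cell averages of a polynomial are polynomials in the mesh size, and tau is
    quadratic in them. *)
Lemma tau_form_in_mesh w : exists P : {poly R}, forall rho,
  tau_form (poly_averages w rho) (poly_averages w rho) = P.[rho].
Proof.
pose delta (i : 'rV[int]_n) : 'rV[int]_n -> R := fun j => (j == i)%:R.
exists (\sum_(i <- Sopt W) \sum_(j <- Sopt W)
   tau_form (delta i) (delta j) *: (avg_in_mesh w i * avg_in_mesh w j)) => rho.
rewrite (local_linearE _ (tau_form_bilinear.2 _)) horner_sum.
apply: eq_bigr => i _; rewrite horner_sum (local_linearE _ (tau_form_bilinear.1 _)).
rewrite mulr_sumr; apply: eq_bigr => j _.
by rewrite hornerZ hornerM !avg_in_meshE mulrA [RHS]mulrC.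
Qed.

(** A polynomial with nonvanishing gradient at the origin competes in the
    minimum that defines the order of tau; as its tau is the absolute value of
    a polynomial in the mesh size, it has an order, so that this order is at
    least the minimum. *)
Lemma tau_form_Opow_noncritical (th : \bar R) (r : R) w i :
  lbound (tau_orders_ncp0 W) th -> (r%:E <= th)%E -> mcoeff (mnm1 i) w != 0 ->
  Opow (fun rho => tau_form (poly_averages w rho) (poly_averages w rho)) r.
Proof.
move=> thlb rth wi; have [P PE] := tau_form_in_mesh w.
under eq_fun do rewrite PE.
have [->|P0] := eqVneq P 0.
  by under eq_fun do rewrite horner0; exact: Opow0.
have tauP : \forall rho \near 0^'+, tau W (peval w) rho = `|P.[rho]|.
  near=> rho; have rho0 : 0 < rho by near: rho; exact: nbhs_right_gt.
  by rewrite tauE// averages_peval// PE.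
have [j [Pj Oj]] := has_order_poly P0 tauP.
apply: OpowW Oj; rewrite -lee_fin (le_trans rth)//; apply: thlb.
exists (peval w); split => //; first exact: smooth_peval.
exact: critical_order_peval wi.
Unshelve. all: by end_near. Qed.

(** Critical points cannot lower the order of tau, because tau is a quadratic
    form: by the parallelogram law its value at [w] is determined by its values
    at [w + h], [w - h] and [h], and a large linear [h] makes the gradients of
    all three nonzero. *)
Lemma tau_form_Opow (th : \bar R) (r : R) w : (0 < n)%N ->
  lbound (tau_orders_ncp0 W) th -> (r%:E <= th)%E ->
  Opow (fun rho => tau_form (poly_averages w rho) (poly_averages w rho)) r.
Proof.
move=> n0 thlb rth; pose i := Ordinal n0; pose b := mcoeff (mnm1 i) w.
pose h : mpoly n R := (`|b| + 1) *: mpolyX R (mnm1 i).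
have hi c : mcoeff (mnm1 i) (c *: h + w) = c * (`|b| + 1) + b.
  by rewrite mcoeffD !mcoeffZ mcoeffX eqxx mulr1.
have lb := ler_norm b; have lNb := ler_norm (- b); rewrite normrN in lNb.
pose Q p rho := tau_form (poly_averages p rho) (poly_averages p rho).
have OQ p : mcoeff (mnm1 i) p != 0 -> Opow (Q p) r.
  by move=> p1; exact: tau_form_Opow_noncritical thlb rth p1.
have Oh : Opow (Q h) r.
  by apply: OQ; rewrite mcoeffZ mcoeffX eqxx mulr1 gt_eqF// ltr_wpDl.
have Op : Opow (Q (1 *: h + w)) r by apply: OQ; rewrite hi; apply/eqP; lra.
have Om : Opow (Q (-1 *: h + w)) r by apply: OQ; rewrite hi; apply/eqP; lra.
apply: Opow_near (OpowZ 2^-1 (OpowB (OpowD Op Om) (OpowZ 2 Oh))).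
have expand c rho : Q (c *: h + w) rho =
  c ^+ 2 * Q h rho
  + c * (tau_form (poly_averages h rho) (poly_averages w rho) +
         tau_form (poly_averages w rho) (poly_averages h rho))
  + Q w rho.
  rewrite /Q poly_averages_linear ((tau_form_bilinear.2 _).1 c).
  by rewrite !((tau_form_bilinear.1 _).1 c); ring.
by near=> rho; rewrite !expand -/(Q w rho); field.
Unshelve. all: by end_near. Qed.

Lemma quadratic_diff (B : ('rV[int]_n -> R) -> ('rV[int]_n -> R) -> R) v v' :
  local_bilinear (Sopt W) B ->
  B v v = B v' v' + (B v' (fun i => v i - v' i) + B (fun i => v i - v' i) v'
    + B (fun i => v i - v' i) (fun i => v i - v' i)).
Proof.
move=> [B2 B1]; pose e i := v i - v' i.
have vE : v = (fun i => 1 * e i + v' i) by apply/funext => i; rewrite mul1r subrK.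
rewrite -/e {1 2}vE (B1 _).1 !(B2 _).1; ring.
Qed.

(** Replace [u] by a Taylor polynomial of degree so high that the error falls
    below the order [r]. *)
Lemma tau_Opow (th : \bar R) (r : R) u : (0 < n)%N -> smooth_near0 u ->
  lbound (tau_orders_ncp0 W) th -> (r%:E <= th)%E -> Opow (tau W u) r.
Proof.
move=> n0 su thlb rth.
have [N rN] : exists N : nat, r <= N%:R.
  by exists (Num.bound `|r|); apply: le_trans (ler_norm r) _; exact/ltW/archi_boundP.
have [w [C [_ uw]]] := taylor_polynomial N su.
pose e rho i := averages W u rho i - poly_averages w rho i.
have eN i : Opow (e^~ i) N%:R by exact: averages_near uw.
have w0 i : Opow ((poly_averages w)^~ i) 0 by exact: (poly_averages_Opow (p := 0)).
apply: Opow_near (Opow_norm (OpowD (tau_form_Opow w n0 thlb rth)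
  (OpowW rN (OpowD (OpowD (f := fun rho => tau_form (poly_averages w rho) (e rho))
     (g := fun rho => tau_form (e rho) (poly_averages w rho)) _ _)
     (g := fun rho => tau_form (e rho) (e rho)) _)))).
- near=> rho; have rho0 : 0 < rho by near: rho; exact: nbhs_right_gt.
  by rewrite tauE// (quadratic_diff (averages W u rho) (poly_averages w rho) tau_form_bilinear).
- rewrite -[N%:R]add0r.
  exact: (Opow_local_bilinear tau_form_bilinear (fun i _ => w0 i) (fun i _ => eN i)).
- rewrite -[N%:R]addr0.
  exact: (Opow_local_bilinear tau_form_bilinear (fun i _ => eN i) (fun i _ => w0 i)).
- apply: (@OpowW _ _ (N%:R + N%:R)); first by rewrite lerDl.
  exact: (Opow_local_bilinear tau_form_bilinear (fun i _ => eN i) (fun i _ => eN i)).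
Unshelve. all: by end_near. Qed.

End Reconstruction.

(** * Expansion of the indicators *)

Section Indicators.
Variables (R : realType) (n m : nat) (W : cwenoz R n m).
Variables (u : 'rV[R]_n -> R) (w : mpoly n R).
Implicit Types (k : 'I_m.+1) (rho : R).
Local Notation s := (aspect W).
Local Notation s_gt0 := (aspect_gt0 W).
Local Notation g := (gdeg W).
Hypothesis w_size : (msize w <= g.+1)%N.
Hypothesis w_near : forall i,
  Opow (fun rho => averages W u rho i - poly_averages W w rho i) g.+1%:R.

(** The constant term is invisible to the indicators; removing it makes the
    cell averages as small as the lowest nonconstant term. *)
Let w0 : mpoly n R := w - mpolyC n (mcoeff mnm0 w).

Let w0E a : mcoeff a w0 = if a == mnm0 then 0 else mcoeff a w.
Proof.
rewrite mcoeffB mcoeffC; case: eqP => [->|]; first by rewrite mulr1 subrr.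
by rewrite mulr0 subr0.
Qed.

Let w0_size : (msize w0 <= g.+1)%N.
Proof.
apply/msize_leP => a ga; rewrite w0E; case: eqP => // _.
by move/msize_leP: w_size; apply.
Qed.

(** The part of the indicators that is the same for all candidates: every
    candidate reproduces the Taylor polynomial [w]. *)
Definition common_indicator rho : R :=
  js_form s g (dilate rho w0) (dilate rho w0).

Lemma indicator_form_shift k (c : R) (v : 'rV[int]_n -> R) :
  indicator_form W k (fun i => c + v i) (fun i => c + v i) = indicator_form W k v v.
Proof.
have -> : (fun i => c + v i) = (fun i => 1 * poly_avg s i (mpolyC n c) + v i).
  by apply/funext => i; rewrite poly_avgC ?mul1r// => j; exact: aspect_gt0.
rewrite /indicator_form candidate_linear candidate_avg; last first.
  by rewrite msizeC (leq_trans (leq_b1 _)).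
rewrite !js_form_linear !(js_formC _ _ (_ + _)) !js_form_linear.
by rewrite !js_form_const (js_formC _ _ _ (mpolyC _ _)) js_form_const !(mulr0, add0r).
Qed.

(** The candidates differ from [w] by O(rho^(g+1)), and the nonconstant part
    of [w] is O(rho^p); the first error term of the quadratic form is bilinear
    in the two. *)
Lemma indicator_expansion k (p : nat) : (p <= g.+1)%N ->
  (forall a, (1 <= mdeg a < p)%N -> mcoeff a w = 0) ->
  Opow (fun rho => Ik W k u rho - common_indicator rho) (p + g.+1)%:R /\
  Opow common_indicator (p + p)%:R.
Proof.
move=> pg wp; pose f := poly_averages W w0.
have fO i : Opow (f^~ i) p%:R.
  apply: poly_averages_Opow => a ap; rewrite w0E; case: eqP => // /eqP.
  by rewrite -mdeg_eq0 -lt0n => a1; rewrite wp ?a1.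
have commonE j rho : common_indicator rho = indicator_form W j (f rho) (f rho).
  rewrite /indicator_form candidate_avg; last exact: msize_dilate.
  by rewrite (@js_form_degree _ _ _ g (degree W j)) ?gdeg_le_degree//; exact: msize_dilate.
split; last first.
  have /funext -> := commonE ord0; rewrite natrD.
  exact: (Opow_local_bilinear (indicator_form_bilinear W ord0) (fun i _ => fO i) (fun i _ => fO i)).
pose e rho i := averages W u rho i - poly_averages W w rho i.
have Bk := indicator_form_bilinear W k.
have Bfe := Opow_local_bilinear Bk (fun i _ => fO i) (fun i _ => w_near i).
have Bef := Opow_local_bilinear Bk (fun i _ => w_near i) (fun i _ => fO i).
have Bee := Opow_local_bilinear Bk (fun i _ => w_near i) (fun i _ => w_near i).
rewrite addrC -!natrD in Bef; rewrite -!natrD in Bfe, Bee.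
have pgg : (p + g.+1)%:R <= (g.+1 + g.+1)%:R :> R by rewrite ler_nat leq_add2r.
apply: Opow_near (OpowD (OpowD Bfe Bef) (OpowW pgg Bee)).
near=> rho; have rho0 : 0 < rho by near: rho; exact: nbhs_right_gt.
rewrite (IkE W k u rho0) (commonE k); set c := mcoeff mnm0 w.
pose z i := averages W u rho i - c.
have -> : indicator_form W k (averages W u rho) (averages W u rho) =
    indicator_form W k z z.
  rewrite -(indicator_form_shift k c z); congr indicator_form; apply/funext => i;
    by rewrite /z addrC subrK.
have zf : (fun i => z i - f rho i) = e rho.
  apply/funext => i; rewrite /z /e /f /poly_averages !linearB /=.
  rewrite (_ : dilate rho (mpolyC n _) = mpolyC n c); last first.
    by rewrite -alg_mpolyC linearZ /= -mpolyX0 dilateX mdeg0 expr0 scale1r.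
  by rewrite poly_avgC; [ring|exact: aspect_gt0].
rewrite (quadratic_diff z (f rho) (indicator_form_bilinear W k)) zf.
by rewrite [RHS]addrC addKr.
Unshelve. all: by end_near. Qed.

(** The mean of the derivative [a] of the rescaled [w] is [rho ^+ |a|] times a
    polynomial in [rho] whose value at 0 is a nonzero multiple of the
    coefficient. *)
Lemma common_indicator_ge (a : multinom n) : (1 <= mdeg a <= g)%N ->
  mcoeff a w != 0 -> exists2 c, 0 < c &
  \forall rho \near 0^'+, c * rho `^ (mdeg a + mdeg a)%:R <= common_indicator rho.
Proof.
move=> ag wa; pose r := mderivm a w0; pose P := avg_in_mesh W r 0.
pose K := mpow s (fun j => (2 * a j)%N%:Z - 1) * \prod_j s 0 j.
have K0 : 0 < K by apply: js_weight_gt0; exact: aspect_gt0.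
have P0 : P.[0] != 0.
  rewrite avg_in_meshE /poly_averages.
  rewrite (_ : dilate 0 r = mpolyC n (mcoeff mnm0 r)); last first.
    apply/mpolyP => b; rewrite mcoeff_dilate mcoeffC expr0n mdeg_eq0.
    by case: eqP => [->|]; rewrite ?mul1r ?mulr1// mul0r mulr0.
  rewrite poly_avgC; last exact: aspect_gt0.
  rewrite /r mcoeff_mderivm addm0 w0E -mdeg_eq0.
  case: (mdeg a =P 0%N) => [a0|_]; first by rewrite a0 in ag.
  rewrite mulrn_eq0 negb_or wa andbT -lt0n prodn_gt0// => j.
  by rewrite ffactnn fact_gt0.
exists (K * (`|P.[0]| / 2) ^+ 2).
  by rewrite mulr_gt0// exprn_gt0// divr_gt0// normr_gt0.
have Pc : P.[x] @[x --> (0 : R)^'+] --> P.[0].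
  by apply: cvg_at_right_filter; exact: continuous_horner.
have P2 : 0 < `|P.[0]| / 2 by rewrite divr_gt0// normr_gt0.
near=> rho; have rho0 : 0 < rho by near: rho; exact: nbhs_right_gt.
apply: le_trans (js_form_ge s_gt0 _ ag); rewrite -/K -mulrA ler_pM2l//.
rewrite mderivm_dilate linearZ /= [leRHS]exprMn.
rewrite powR_mulrn ?(ltW rho0)// exprD mulrC -expr2.
rewrite ler_pM2l; last by rewrite !exprn_gt0.
rewrite -[X in _ <= X ^+ 2](_ : P.[rho] = _); last by rewrite avg_in_meshE.
rewrite -[leRHS]real_normK ?num_real//; apply: lerXn2r; rewrite ?nnegrE//.
have : `|P.[0] - P.[rho]| <= `|P.[0]| / 2.
  by near: rho; exact: (cvgr_dist_le _ _ Pc _ P2).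
by move/(le_trans (ler_dist_dist _ _)); rewrite ler_norml; lra.
Unshelve. all: by end_near. Qed.

End Indicators.

(** * Accuracy of the combined polynomial *)

Section Accuracy.
Variables (R : realType) (n m : nat) (W : cwenoz R n m) (u : 'rV[R]_n -> R).
Implicit Types (k : 'I_m.+1) (rho : R).

Lemma dcoef_Pk rho : \sum_k dcoef W k *: Pk W k u rho = Popt W u rho.
Proof.
rewrite big_ord_recl /Pk unlift_none /Pzero scalerA divff ?scale1r; last first.
  exact/lt0r_neq0/dcoef_gt0.
by under [X in _ + X]eq_bigr do rewrite liftK; rewrite subrK.
Qed.

(** [P_0] is a linear combination with coefficients summing to 1 of polynomials
    accurate to order [g + 1]. *)
Lemma accuracy_Pk : accuracy W (Gdeg W).+1 u (Popt W u) ->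
  (forall k : 'I_m, accuracy W (gdeg W).+1 u (Plow W k u)) ->
  forall k, accuracy W (gdeg W).+1 u (Pk W k u).
Proof.
move=> [C Popt_acc] /choice[D Plow_acc] k; rewrite /accuracy /Pk.
case: (unliftP ord0 k) => [j _|_]; first by exists (D j).
exists ((dcoef W ord0)^-1 * (`|C| + \sum_j dcoef W (lift ord0 j) * D j)).
have Plow_acc' : \forall rho \near 0^'+, forall j x, cell (mesh W rho) 0 x ->
    `|peval (Plow W j u rho) x - u x| <= D j * rho ^+ (gdeg W).+1.
  by apply: filter_forall => j; exact: Plow_acc.
near=> rho => x x0.
have /andP[rho0 rho1] : 0 < rho <= 1 by near: rho; exact: near0_le1.
have d0 := dcoef_gt0 W ord0.
have Popt_x : `|peval (Popt W u rho) x - u x| <= `|C| * rho ^+ (gdeg W).+1.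
  apply: le_trans (near Popt_acc rho _ x x0) _ => //.
  apply: (@le_trans _ _ (`|C| * rho ^+ (Gdeg W).+1)).
    by rewrite ler_wpM2r ?exprn_ge0 ?(ltW rho0)// ler_norm.
  by rewrite ler_wpM2l// ler_wiXn2l ?(ltW rho0)// ltnS ltnW// gdeg_lt.
have -> : peval (Pzero W u rho) x - u x = (dcoef W ord0)^-1 *
    ((peval (Popt W u rho) x - u x) - \sum_j dcoef W (lift ord0 j) *
      (peval (Plow W j u rho) x - u x)).
  have dsum : \sum_(j < m) dcoef W (lift ord0 j) = 1 - dcoef W ord0.
    by rewrite -(dcoef_sum W) big_ord_recl addrC addKr.
  under [\sum_j _ * (_ - u x)]eq_bigr do rewrite mulrBr.
  rewrite sumrB -mulr_suml dsum [peval _ x]mevalZ mevalB -!/(peval _ _) peval_lincomb.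
  by field; exact: lt0r_neq0.
rewrite normrM gtr0_norm ?invr_gt0// -mulrA ler_pM2l ?invr_gt0//.
apply: le_trans (ler_normB _ _) _; rewrite mulrDl lerD//.
apply: le_trans (ler_norm_sum _ _ _) _; rewrite mulr_suml ler_sum// => j _.
rewrite normrM gtr0_norm ?dcoef_gt0// -mulrA ler_pM2l ?dcoef_gt0//.
exact: (near Plow_acc').
Unshelve. all: by end_near. Qed.

(** As the weights and the [d_k] both sum to 1, [P_rec - u] is
    [\sum_k (omega_k - d_k) (P_k - u)] plus [P_opt - u]: each summand multiplies
    an O(rho^(G-g)) with an O(rho^(g+1)). *)
Lemma accuracy_Prec (eps : R -> R) (ell : R) :
  (forall rho, \sum_k omega W (eps rho) ell u rho k = 1) ->
  (forall k, Opow (fun rho => omega W (eps rho) ell u rho k - dcoef W k)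
    (Gdeg W - gdeg W)%:R) ->
  accuracy W (Gdeg W).+1 u (Popt W u) ->
  (forall k, accuracy W (gdeg W).+1 u (Pk W k u)) ->
  accuracy W (Gdeg W).+1 u (fun rho => Prec W (eps rho) ell u rho).
Proof.
move=> omega1 /choice[C omegaC] [D Popt_acc] /choice[E Pk_acc].
exists (\sum_k C k * E k + D).
have omegaC' : \forall rho \near 0^'+, forall k,
    `|omega W (eps rho) ell u rho k - dcoef W k| <= C k * rho `^ (Gdeg W - gdeg W)%:R.
  by apply: filter_forall => k; exact: omegaC.
have Pk_acc' : \forall rho \near 0^'+, forall k x, cell (mesh W rho) 0 x ->
    `|peval (Pk W k u rho) x - u x| <= E k * rho ^+ (gdeg W).+1.
  by apply: filter_forall => k; exact: Pk_acc.
near=> rho => x x0; have rho0 : 0 < rho by near: rho; exact: nbhs_right_gt.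
have -> : peval (Prec W (eps rho) ell u rho) x - u x =
    \sum_k (omega W (eps rho) ell u rho k - dcoef W k) *
      (peval (Pk W k u rho) x - u x) + (peval (Popt W u rho) x - u x).
  rewrite -(dcoef_Pk rho) /Prec !peval_lincomb.
  under [\sum_k (_ - _) * _]eq_bigr do rewrite mulrBl !mulrBr.
  have om1 := omega1 rho; rewrite /omega -mulr_suml in om1.
  by rewrite !sumrB -!mulr_suml om1 dcoef_sum; ring.
apply: le_trans (ler_normD _ _) _; rewrite mulrDl lerD//; last exact: (near Popt_acc).
apply: le_trans (ler_norm_sum _ _ _) _; rewrite mulr_suml ler_sum// => k _.
have -> : rho ^+ (Gdeg W).+1 = rho `^ (Gdeg W - gdeg W)%:R * rho ^+ (gdeg W).+1.
  by rewrite powR_mulrn ?(ltW rho0)// -exprD addnS subnK// ltnW// gdeg_lt.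
rewrite normrM mulrACA ler_pM//; first exact: (near omegaC').
exact: (near Pk_acc').
Unshelve. all: by end_near. Qed.

End Accuracy.

(** * Optimal order of the reconstruction *)

Theorem theorem1 (R : realType) (n m : nat) (hn : (0 < n)%N) (hm : (0 < m)%N)
  (W : cwenoz R n m) (u : 'rV[R]_n -> R) (hu : smooth_near0 u)
  (accPopt : accuracy W (Gdeg W).+1 u (Popt W u))
  (accPlow : forall k : 'I_m, accuracy W (gdeg W).+1 u (Plow W k u))
  (M : nat) (hM : (1 <= M <= gdeg W)%N)
  (expPopt : moment_expansion W M u (Popt W u))
  (expPlow : forall k : 'I_m, moment_expansion W M u (Plow W k u))
  (eps : R -> R) (Ceps mhat : R) (hCeps : Ceps != 0)
  (heps : forall rho : R, 0 < rho -> eps rho = Ceps * rho `^ mhat)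
  (eps_gt0 : forall rho : R, 0 < rho -> 0 < eps rho)
  (ell : R) (hell : 1 <= ell)
  (theta_tau : \bar R) (htheta : is_min (tau_orders_ncp0 W) theta_tau)
  (ha : mhat <= 2 * M%:R + 1)
  (hb : (Gdeg W)%:R - (gdeg W)%:R - 1 <= ell * (2 * M%:R + 2 - mhat))
  (hc : (((Gdeg W)%:R - (gdeg W)%:R - 1)%:E
         <= ell%:E * (theta_tau - (Num.min mhat (2 * M%:R))%:E))%E) :
  accuracy W (Gdeg W).+1 u (fun rho => Prec W (eps rho) ell u rho).
Proof.
have gG := gdeg_lt W; move: hM => /andP[M1 Mg].
set D : R := (Gdeg W)%:R - (gdeg W)%:R - 1 in hb hc.
have D0 : 0 <= D.
  have : (gdeg W).+1%:R <= (Gdeg W)%:R :> R by rewrite ler_nat.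
  by rewrite -natr1 /D; lra.
have DE : (Gdeg W - gdeg W)%:R = D + 1 by rewrite natrB ?(ltnW gG)// /D subrK.
have Ceps0 : 0 < Ceps.
  by have := eps_gt0 1 ltr01; rewrite heps// powR1 mulr1.
set mu := Num.min mhat (2 * M%:R) in hc.
(* when the minimal order of tau is infinite, any large enough real will do *)
have [r rth rD] : exists2 r : R, (r%:E <= theta_tau)%E & D <= ell * (r - mu).
  case: theta_tau htheta hc => [t||] [[v [_ _ vr]] _] //= tD; first by exists t.
  exists (mu + D); first exact: leey.
  by rewrite addrAC subrr add0r ler_peMl.
have tau_r : Opow (tau W u) r by exact: tau_Opow htheta.2 rth.
have [w [C [w_size uw]]] := taylor_polynomial (gdeg W).+1 hu.
have w_near i := averages_near W i uw.
pose y k rho := Ik W k u rho + eps rho.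
have I0 k rho : 0 < rho -> 0 <= Ik W k u rho.
  by move=> rho0; rewrite IkE// js_form_ge0//; exact: aspect_gt0.
have y_ge_eps k : \forall rho \near 0^'+, Ceps * rho `^ mhat <= y k rho.
  near=> rho; have rho0 : 0 < rho by near: rho; exact: nbhs_right_gt.
  by rewrite /y heps// lerDr I0.
have y_gt0 k : \forall rho \near 0^'+, 0 < y k rho.
  near=> rho; have rho0 : 0 < rho by near: rho; exact: nbhs_right_gt.
  by rewrite ltr_wpDl ?I0 ?eps_gt0.
(* both cases below supply an exponent [e] for tau / y_k, and the relative
   O(rho) closeness of the y_k *)
suff [e De [tau_le I_close]] : exists2 e, D <= ell * e &
    (forall k, exists C, \forall rho \near 0^'+,
       tau W u rho <= C * rho `^ e * y k rho) /\
    (forall k j, exists C, \forall rho \near 0^'+,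
       `|Ik W k u rho - Ik W j u rho| <= C * rho * y j rho).
  apply: accuracy_Prec => // [rho|k|]; last exact: accuracy_Pk.
    have alpha_gt0 k : 0 < alphaZ W (eps rho) ell u rho k.
      by rewrite /alphaZ mulr_gt0 ?dcoef_gt0// ltr_wpDr ?powR_ge0.
    rewrite /omega -mulr_suml divff//; apply/lt0r_neq0.
    by rewrite (bigD1 ord0)//= ltr_wpDr// sumr_ge0// => k _; exact: ltW.
  rewrite DE; apply: nonlinear_weight_close De k => //.
  - exact: dcoef_gt0.
  - exact: dcoef_sum.
  - by move=> rho; exact: normr_ge0.
  - move=> k j; have [C' IC] := I_close k j; exists C'.
    by under eq_near do rewrite /y opprD addrACA subrr addr0.
have y_ge_I (c nu : R) : (forall k, \forall rho \near 0^'+,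
    c * rho `^ nu <= Ik W k u rho) ->
    forall k, \forall rho \near 0^'+, c * rho `^ nu <= y k rho.
  move=> Ic k; near=> rho; have rho0 : 0 < rho by near: rho; exact: nbhs_right_gt.
  by rewrite /y (le_trans (near (Ic k) rho _))// lerDl ltW// eps_gt0.
have tau_le_of (c nu r' : R) : 0 < c -> Opow (tau W u) r' ->
    (forall k, \forall rho \near 0^'+, c * rho `^ nu <= y k rho) ->
    forall k, exists C, \forall rho \near 0^'+,
       tau W u rho <= C * rho `^ (r' - nu) * y k rho.
  move=> c0 tau_r' cy k; have [C' tC] := Opow_le_lower c0 (cy k) tau_r'.
  exists C'; near=> rho; rewrite -[leLHS]ger0_norm ?normr_ge0//.
  by near: rho.
have I_close_of (c nu : R) (J : R -> R) : 0 < c ->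
    (forall k, \forall rho \near 0^'+, c * rho `^ nu <= y k rho) ->
    (forall k, Opow (fun rho => Ik W k u rho - J rho) (nu + 1)) ->
    forall k j, exists C, \forall rho \near 0^'+,
      `|Ik W k u rho - Ik W j u rho| <= C * rho * y j rho.
  move=> c0 cy IJ k j.
  have [C' IC] := Opow_le_lower c0 (cy j) (OpowB (IJ k) (IJ j)).
  exists C'; near=> rho; have rho0 : 0 < rho by near: rho; exact: nbhs_right_gt.
  have -> : Ik W k u rho - Ik W j u rho =
      Ik W k u rho - J rho - (Ik W j u rho - J rho) by ring.
  have -> : C' * rho = C' * rho `^ (nu + 1 - nu).
    by rewrite addrAC subrr add0r powRr1// ltW.
  by near: rho.
pose lowest p := `[< exists a, [/\ mdeg a = p, (1 <= p <= M)%N & mcoeff a w != 0] >].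
have [/ex_minnP[p /asboolP[a [ap /andP[p1 pM] wa]] pmin]|no_low] :=
  pselect (exists p, lowest p).
(* the Taylor polynomial has a nonconstant term of degree p <= M: the
   indicators are at least of the order of rho^(2p), and (c) applies *)
- have wp b : (1 <= mdeg b < p)%N -> mcoeff b w = 0.
    move=> /andP[b1 bp]; apply/eqP; apply: contraTT bp => wb; rewrite -leqNgt.
    have [bM|Mb] := leqP (mdeg b) M; last by rewrite (leq_trans pM)// ltnW.
    by apply: pmin; apply/asboolP; exists b; rewrite b1 bM.
  have pg : (p <= gdeg W)%N by exact: leq_trans Mg.
  have IJ k := (indicator_expansion w_size w_near k (leqW pg) wp).1.
  have [c c0 Jc] : exists2 c, 0 < c & \forall rho \near 0^'+,
      c * rho `^ (p + p)%:R <= common_indicator W w rho.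
    by rewrite -ap; apply: common_indicator_ge; rewrite ?ap ?p1.
  have IJ1 k : Opow (fun rho => Ik W k u rho - common_indicator W w rho)
      ((p + p)%:R + 1).
    by apply: OpowW (IJ k); rewrite natr1 ler_nat -addnS leq_add2l ltnS.
  have Ic k : \forall rho \near 0^'+, c / 2 * rho `^ (p + p)%:R <= Ik W k u rho.
    have [C' C'0 IC] := OpowP (IJ1 k).
    near=> rho; have rho0 : 0 < rho by near: rho; exact: nbhs_right_gt.
    have rhoc : rho <= c / 2 / C' by near: rho; apply: nbhs_right_le; rewrite !divr_gt0.
    have Jr : c * rho `^ (p + p)%:R <= common_indicator W w rho.
      by near: rho; exact: Jc.
    have : `|Ik W k u rho - common_indicator W w rho| <=
        C' * (rho `^ (p + p)%:R * rho).
      have <- : rho `^ ((p + p)%:R + 1) = rho `^ (p + p)%:R * rho.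
        by rewrite powRD ?powRr1 ?(ltW rho0)// (gt_eqF rho0) implybT.
      by near: rho; exact: IC.
    have : C' * (rho `^ (p + p)%:R * rho) <= c / 2 * rho `^ (p + p)%:R.
      by rewrite mulrCA mulrC ler_wpM2r ?powR_ge0// mulrC -ler_pdivlMr.
    rewrite ler_norml; lra.
  have c2 : 0 < c / 2 by rewrite divr_gt0.
  have [c' c'0 y_mu] : exists2 c', 0 < c' & forall k,
      \forall rho \near 0^'+, c' * rho `^ mu <= y k rho.
    rewrite /mu minEle; case: ifP => _; first by exists Ceps.
    exists (c / 2) => //; apply: y_ge_I => k; near=> rho.
    apply: le_trans (near (Ic k) rho _) => //; rewrite ler_pM2l//.
    apply: ger_powR; first by near: rho; exact: near0_le1.
    by rewrite -natrM ler_nat mul2n -addnn leq_add.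
  exists (r - mu) => //; split; first exact: tau_le_of c'0 tau_r y_mu.
  exact: I_close_of c2 (y_ge_I _ _ Ic) IJ1.
(* it has none: the indicators and tau are O(rho^(2M+2)), epsilon dominates,
   and (a) and (b) apply *)
- have wp b : (1 <= mdeg b < M.+1)%N -> mcoeff b w = 0.
    rewrite ltnS => bM; apply/eqP/negPn/negP => wb; apply: no_low.
    by exists (mdeg b); apply/asboolP; exists b.
  have MM : (M.+1 + M.+1)%:R = 2 * M%:R + 2 :> R by rewrite natrD -natr1; ring.
  have [_ J2] := indicator_expansion w_size w_near ord0 (Mg : M < (gdeg W).+1)%N wp.
  have IJ k : Opow (fun rho => Ik W k u rho - common_indicator W w rho)
      (M.+1 + M.+1)%:R.
    apply: OpowW (indicator_expansion w_size w_near k _ wp).1 => //.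
    by rewrite ler_nat leq_add2l ltnS.
  have tau2 : Opow (tau W u) (2 * M%:R + 2).
    rewrite -MM; apply: Opow_norm; apply: Opow_sum => k _ _; apply: OpowZ.
    apply: Opow_near (OpowD (IJ k) J2).
    by near=> rho; rewrite subrK.
  exists (2 * M%:R + 2 - mhat) => //; split; first exact: tau_le_of Ceps0 tau2 y_ge_eps.
  apply: I_close_of Ceps0 y_ge_eps _ => k.
  by apply: OpowW (IJ k); rewrite MM; lra.
Unshelve. all: by end_near. Qed.
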